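(* Let $2<q<\infty$ and set $S := \frac{(2\pi)^2}{q-2}$. Then there is a constant $c_q>0$ (depending only on $q$) such that for all real-valued $u\in H^1(\mathbb{R}/\mathbb{Z})$ with $u\not\equiv 0$, $$ \int_0^1 \left( (u')^2 + S u^2\right)dt - S \left( \int_0^1 |u|^q\,dt \right)^{2/q} \geq c_q\, \frac{ \left( \int_0^1 \left( (u')^2 + S \left(u-\int_0^1 u\,ds \right)^2\right)dt \right)^2}{\int_0^1 \left( (u')^2 + S u^2\right)dt}\,. $$
   Context: $H^1(\mathbb{R}/\mathbb{Z})$ denotes the Sobolev space of real-valued one-periodic functions with square-integrable weak derivative. *)

(* Defs.v *)
From HB Require Import structures.
From mathcomp Require Import all_boot all_order all_algebra.
From mathcomp Require Import all_classical all_reals all_analysis.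
Set Implicit Arguments.
Unset Strict Implicit.
Unset Printing Implicit Defensive.
Import Order.TTheory GRing.Theory Num.Theory.
Import numFieldNormedType.Exports.
Local Open Scope classical_set_scope.
Local Open Scope ring_scope.

(* Functions on R/Z are exactly 1-periodic functions on R; elements of L^p and
   H^1 are represented by such functions rather than by classes modulo a.e.
   equality. *)

Definition circle_int {R : realType} (f : R -> R) : R :=
  \int[lebesgue_measure]_(t in `[0, 1]) f t.

(* `circle_int` is 0 on a nonnegative function of infinite integral, so
   integrability has to be stated separately, as here. *)
Definition circle_Lfun {R : realType} (p : \bar R) (f : R -> R) : Prop :=
  periodic f 1 /\ f \_ `[0, 1] \in Lfun lebesgue_measure p.

Definition circle_test {R : realType} (phi : R -> R) : Prop :=
  periodic phi 1 /\ forall (n : nat) (t : R), derivable (derive1n n phi) t 1.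

Definition circle_weak_derivative {R : realType} (u du : R -> R) : Prop :=
  [/\ circle_Lfun 1 u, circle_Lfun 1 du &
      forall phi : R -> R, circle_test phi ->
        circle_int (fun t => u t * derive1 phi t) =
        - circle_int (fun t => du t * phi t)].

Definition circle_H1 {R : realType} (u : R -> R) : Prop :=
  circle_Lfun 2%:E u /\
  exists2 du, circle_Lfun 2%:E du & circle_weak_derivative u du.

(* Main.v *)
Require Import Defs.
From HB Require Import structures.
From mathcomp Require Import all_boot all_order all_algebra.
From mathcomp Require Import all_classical all_reals all_analysis.
From mathcomp Require Import measurable_realfun ring lra.
Import Order.TTheory GRing.Theory Num.Theory.
Import numFieldNormedType.Exports.
Local Open Scope classical_set_scope.
Local Open Scope ring_scope.

(** Write S = (2 pi)^2 / (q - 2), D, A and X for the integrals of u'^2, u^2 and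
    |u|^q, and M = X^(2/q). The theorem follows from the improved inequality

      S (M - A) + c (M - A)^2 / M <= D,    A <= M,

    since the squared distance of u to the constants is comparable to D by the
    Poincare inequality: if S (M - A) <= D / 2 the deficit D - S (M - A) is at
    least D / 2, and otherwise it is at least c (M - A)^2 / M, which is of order
    D^2 / (D + S A) ([stability_of_improved]).

    The improved inequality is a Bakry-Emery argument. For a positive function
    r = |u|^q, let r evolve by the heat equation r_t = r''. The integral of r,
    hence M, is conserved, A increases to M, and D decreases to 0. Integrating
    by parts, dA/dt is 2 (q - 2) D ([entropy_dissipation]), whereas -dD/dt is
    2 int u''^2 plus a positive multiple of int u'^4 / u^2
    ([fisher_dissipation]). The sharp Poincare inequality ([wirtinger]) bounds
    the first term by 8 pi^2 D and the Cauchy-Schwarz inequality bounds the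
    second from below by a multiple of D^2 / A. Therefore D - S (M - A) decreases
    along the flow, to its limit 0, so it is nonnegative; inserting
    D >= S (M - A) in the term D^2 / A, one finds that
    D - S (M - A) - c (M - A)^2 / M also decreases to 0 ([flow_comparison]).

    The flow is only run for initial data that are trigonometric polynomials,
    where it is a finite sum: a mode of frequency k is multiplied by s^(k^2) with
    s = exp (- 4 pi^2 t). In terms of s the evolution is polynomial and the limit
    t -> oo is the value at s = 0. Positivity is preserved ([heat_ge]).

    The general case is reached by averaging against the kernel
    cos(pi y)^(2n), suitably normalised, which turns integrable functions into
    trigonometric polynomials, commutes with weak differentiation, does not
    increase L^2 norms and converges at continuity points. It gives successively
    the inequality for positive functions of class C^1, for (v^2 + e^2)^(1/2)
    with v a trigonometric polynomial, and for u itself: the averages of u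
    converge boundedly to a representative of u ([repr_of_cvg], [repr_of_ae]). *)

Set Implicit Arguments.
Unset Strict Implicit.

(** * Derivatives and continuity of real functions *)

Section derivatives.
Context {R : realType}.
Implicit Types (f g F : R -> R) (x a b c : R).

Lemma der_eq f x a b : is_derive x 1 f a -> a = b -> is_derive x 1 f b.
Proof. by move=> fa <-. Qed.

Lemma der_cst c x : is_derive x 1 (fun=> c) 0.
Proof. exact: is_derive_cst. Qed.

Lemma der_id x : is_derive x 1 (fun y : R => y) 1.
Proof. exact: is_derive_id. Qed.

Lemma derD f g x a b : is_derive x 1 f a -> is_derive x 1 g b ->
  is_derive x 1 (fun y => f y + g y) (a + b).
Proof. by move=> fa gb; exact: is_deriveD. Qed.

Lemma derN f x a : is_derive x 1 f a -> is_derive x 1 (fun y => - f y) (- a).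
Proof. by move=> fa; exact: is_deriveN. Qed.

Lemma derB f g x a b : is_derive x 1 f a -> is_derive x 1 g b ->
  is_derive x 1 (fun y => f y - g y) (a - b).
Proof. by move=> fa gb; exact: is_deriveB. Qed.

Lemma derM f g x a b : is_derive x 1 f a -> is_derive x 1 g b ->
  is_derive x 1 (fun y => f y * g y) (a * g x + f x * b).
Proof.
move=> fa gb; have /der_eq := is_deriveM fa gb; apply.
by rewrite /GRing.scale/= addrC mulrC.
Qed.

Lemma derZ c f x a : is_derive x 1 f a -> is_derive x 1 (fun y => c * f y) (c * a).
Proof.
move=> fa; have /der_eq := derM (der_cst c x) fa; apply.
by rewrite mul0r add0r.
Qed.

Lemma derX f n x a : is_derive x 1 f a ->
  is_derive x 1 (fun y => f y ^+ n) (n%:R * f x ^+ n.-1 * a).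
Proof. by move=> fa; have := is_deriveX n fa; rewrite exprfctE. Qed.

Lemma derV f x a : f x != 0 -> is_derive x 1 f a ->
  is_derive x 1 (fun y => (f y)^-1) (- a / f x ^+ 2).
Proof.
move=> f0 fa; have /der_eq := is_deriveV f0 fa; apply.
by rewrite /GRing.scale/= mulNr mulNr mulrC.
Qed.

Lemma der_comp f g x a b : is_derive (g x) 1 f a -> is_derive x 1 g b ->
  is_derive x 1 (fun y => f (g y)) (a * b).
Proof. by move=> fa gb; exact: (is_derive1_comp fa gb). Qed.

Lemma der_affine a b x : is_derive x 1 (fun y => a * y + b) a.
Proof.
have /der_eq := derD (derZ a (der_id x)) (der_cst b x); apply.
by rewrite mulr1 addr0.
Qed.

Lemma der_sum (I : Type) (l : seq I) (F dF : I -> R -> R) x :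
  (forall i, is_derive x 1 (F i) (dF i x)) ->
  is_derive x 1 (fun y => \sum_(i <- l) F i y) (\sum_(i <- l) dF i x).
Proof.
move=> dFx; elim: l => [|i l IH].
  rewrite big_nil (_ : (fun y => _) = cst 0); first exact: is_derive_cst.
  by apply/funext => y; rewrite big_nil.
rewrite big_cons (_ : (fun y => _) = fun y => F i y + \sum_(j <- l) F j y).
  exact: derD.
by apply/funext => y; rewrite big_cons.
Qed.

Lemma der_derivable f x a : is_derive x 1 f a -> derivable f x 1.
Proof. by move=> fa; exact: ex_derive. Qed.

Lemma der_derive1 f x a : is_derive x 1 f a -> derive1 f x = a.
Proof. by move=> fa; rewrite derive1E; exact: derive_val. Qed.

Lemma der_cont f x a : is_derive x 1 f a -> {for x, continuous f}.
Proof. by move=> /der_derivable/derivable1_diffP/differentiable_continuous. Qed.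

Lemma der_continuous f (df : R -> R) :
  (forall x, is_derive x 1 f (df x)) -> continuous f.
Proof. by move=> fd x; exact: der_cont (fd x). Qed.

(** Monotonicity from the sign of the derivative on an interval whose end
    points are interior to the domain of differentiability. *)
Lemma der_ge0_le f (df : R -> R) a b : a <= b ->
  (forall x, a <= x <= b -> is_derive x 1 f (df x)) ->
  (forall x, a < x < b -> 0 <= df x) -> f a <= f b.
Proof.
rewrite le_eqVlt => /predU1P[->//|ab] fd d0.
have [x xab||c cab] := @MVT R f df a b ab.
- by apply: fd; move: xab; rewrite in_itv/= => /andP[/ltW-> /ltW->].
- apply: continuous_in_subspaceT => y; rewrite inE/= in_itv/= => yab.
  exact: der_cont (fd _ yab).
- by move=> fE; rewrite -subr_ge0 fE mulr_ge0 ?subr_ge0 ?(ltW ab)// d0.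
Qed.

Lemma der_eq0_eq f a b : (forall x, is_derive x 1 f 0) -> f a = f b.
Proof. by move=> f0; exact: is_derive_0_is_cst. Qed.

Lemma der_quad f x a C : (forall h, `|h| <= 1 -> `|f (x + h) - f x - a * h| <= C * h ^+ 2) ->
  is_derive x 1 f a.
Proof.
move=> H.
have H0 : h^-1 *: (f (h + x) - f x) @[h --> 0^'] --> a.
  apply/cvgrPdist_le => /= e e0.
  have C0 : 0 <= C.
    have H1 : `|1 : R| <= 1 by rewrite normr1.
    by rewrite -[C]mulr1 -(expr1n _ 2); apply: le_trans (H 1 H1).
  have C1 : 0 < C + 1 by rewrite ltr_wpDl.
  near=> h.
  have h0 : h != 0 by near: h; exact: nbhs_dnbhs_neq.
  have h1 : `|h| <= 1.
    near: h; apply: nbhs_dnbhs; apply/nbhs_ballP; exists 1 => //= y.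
    by rewrite /ball/= sub0r normrN => /ltW.
  have h2 : `|h| <= e / (C + 1).
    near: h; apply: nbhs_dnbhs; apply/nbhs_ballP; exists (e / (C + 1)).
      by rewrite /= divr_gt0.
    by move=> y; rewrite /ball/= sub0r normrN => /ltW.
  have -> : a - h^-1 *: (f (h + x) - f x) = - (h^-1 * (f (x + h) - f x - a * h)).
    rewrite /GRing.scale/= (addrC h) [h^-1 * (_ - a * h)]mulrBr opprB.
    by congr (_ - _); rewrite mulrCA mulVf// mulr1.
  rewrite normrN normrM normfV ler_pdivrMl ?normr_gt0//.
  apply: le_trans (H _ h1) _.
  rewrite -[h ^+ 2]ger0_norm ?sqr_ge0// normrX.
  have : 0 <= `|h| * (e - `|h| * (C + 1)).
    by rewrite mulr_ge0// subr_ge0 -ler_pdivlMr.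
  by have := normr_ge0 h; nra.
split.
  apply/cvg_ex; exists a; under eq_fun do rewrite scaler1.
  exact: H0.
rewrite /derive; under eq_fun do rewrite scaler1.
by apply/cvg_lim => //.
Unshelve. all: by end_near. Qed.

End derivatives.

Section continuity.
Context {R : realType}.
Implicit Types f g : R -> R.

Lemma contD f g : continuous f -> continuous g -> continuous (fun x => f x + g x).
Proof. by move=> cf cg x; apply: cvgD; [exact: cf|exact: cg]. Qed.

Lemma contB f g : continuous f -> continuous g -> continuous (fun x => f x - g x).
Proof. by move=> cf cg x; apply: cvgB; [exact: cf|exact: cg]. Qed.

Lemma contM f g : continuous f -> continuous g -> continuous (fun x => f x * g x).
Proof. by move=> cf cg x; apply: cvgM; [exact: cf|exact: cg]. Qed.

Lemma cont_cst (c : R) : continuous (fun _ : R => c).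
Proof. by move=> x; exact: cvg_cst. Qed.

Lemma contZ c f : continuous f -> continuous (fun x => c * f x).
Proof. by move=> cf; apply: contM => //; exact: cont_cst. Qed.

Lemma contX n f : continuous f -> continuous (fun x => f x ^+ n).
Proof.
move=> cf; elim: n => [|n IH].
  by under eq_fun do rewrite expr0; exact: cont_cst.
by under eq_fun do rewrite exprS; exact: contM.
Qed.

Lemma contV f : continuous f -> (forall x, f x != 0) -> continuous (fun x => (f x)^-1).
Proof. by move=> cf f0 x; apply: cvgV => //; exact: cf. Qed.

Lemma cont_comp f g : continuous f -> continuous g -> continuous (fun x => f (g x)).
Proof. by move=> cf cg x; apply: continuous_comp; [exact: cg|exact: cf]. Qed.

End continuity.
Arguments contX {R} n [f].

(** * The integral over one period *)

Section circle_integral.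
Context {R : realType}.
Local Notation mu := (@lebesgue_measure R).
Local Notation J := (@circle_int R).
Local Notation I01 := (`[0%R, 1%R]%classic : set R).
Local Notation intg f := (mu.-integrable I01 (EFin \o f)).
Implicit Types (f g F : R -> R) (x : R).

Lemma mu_I01 : mu I01 = 1%E.
Proof. by rewrite lebesgue_measure_itv/= lte01 oppr0 adde0. Qed.

Lemma measurable_I01 : measurable (I01 : set (measurableTypeR R)).
Proof. exact: measurable_itv. Qed.

Lemma cont_intg f : continuous f -> intg f.
Proof.
move=> cf; apply: continuous_compact_integrable; first exact: segment_compact.
exact: continuous_subspaceT.
Qed.

Lemma cint_cst c : J (fun=> c) = c.
Proof.
rewrite /circle_int Rintegral_cst; last exact: measurable_I01.
by rewrite [X in fine X]mu_I01 mulr1.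
Qed.

Lemma cintD f g : intg f -> intg g -> J (fun x => f x + g x) = J f + J g.
Proof. by move=> fi gi; exact: RintegralD. Qed.

Lemma cintB f g : intg f -> intg g -> J (fun x => f x - g x) = J f - J g.
Proof. by move=> fi gi; exact: RintegralB. Qed.

Lemma cintZ c f : intg f -> J (fun x => c * f x) = c * J f.
Proof. by move=> fi; exact: RintegralZl. Qed.

Lemma cint_le f g : intg f -> intg g -> (forall x, 0 <= x <= 1 -> f x <= g x) ->
  J f <= J g.
Proof.
by move=> fi gi fg; exact: le_Rintegral.
Qed.

Lemma cint_ge0 f : (forall x, 0 <= x <= 1 -> 0 <= f x) -> 0 <= J f.
Proof.
by move=> f0; exact: Rintegral_ge0.
Qed.

Lemma eq_cint f g : (forall x, 0 <= x <= 1 -> f x = g x) -> J f = J g.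
Proof.
by move=> fg; apply: eq_Rintegral => x /set_mem/=; rewrite in_itv/=; exact: fg.
Qed.

Lemma le_norm_cint f : intg f -> `|J f| <= J (fun x => `|f x|).
Proof. by move=> fi; exact: le_normr_Rintegral. Qed.

Lemma intgD f g : intg f -> intg g -> intg (fun x => f x + g x).
Proof. by move=> fi gi; 
have := integrableD measurable_I01 fi gi. Qed.

Lemma intgB f g : intg f -> intg g -> intg (fun x => f x - g x).
Proof. by move=> fi gi; have := integrableB measurable_I01 fi gi. Qed.

Lemma intgZ c f : intg f -> intg (fun x => c * f x).
Proof. by move=> fi; have := integrableZl measurable_I01 c fi. Qed.

Lemma intg_cst c : intg (fun=> c).
Proof. by apply: cont_intg => x; exact: cvg_cst. Qed.

Lemma cint_FTC F f : (forall x, is_derive x 1 F (f x)) -> continuous f ->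
  J f = F 1 - F 0.
Proof.
move=> Ff cf; rewrite /circle_int /Rintegral.
rewrite (@continuous_FTC2 R f F 0 1)//.
- exact: continuous_subspaceT.
- have cF := der_continuous Ff; split.
  + by move=> x _; exact: der_derivable (Ff x).
  + exact/cvg_at_right_filter/cF.
  + exact/cvg_at_left_filter/cF.
- by move=> x _; exact: der_derive1 (Ff x).
Qed.

(** A continuous function has a primitive on the whole line. *)
Lemma continuous_primitive f : continuous f ->
  exists F, forall x, is_derive x 1 F (f x).
Proof.
move=> cf.
have ifab a b : mu.-integrable `[a, b] (EFin \o f).
  apply: continuous_compact_integrable; first exact: segment_compact.
  exact: continuous_subspaceT.
pose H (a y : R) := \int[mu]_(t in `[a, y]) f t.
have Hab (a b y : R) : a <= b -> b <= y -> b <= 0 -> H a y - H a 0 = H b y - H b 0.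
  move=> ab bz b0.
  have E z : b <= z -> H a z - H a b = H b z.
    move=> bz'; rewrite /H (@Rintegral_itvB _ f (BLeft a) (BRight z) b)//.
    by rewrite Rintegral_itv_obnd_cbnd//; apply: integrableS (ifab b z) => //;
      apply: subset_itvr; rewrite bnd_simp.
  by rewrite -!E//; lra.
(* The base point of the primitive moves with y so as to stay to the left of
   both 0 and y; the difference does not depend on it. *)
pose F y := H (- (`|y| + 1)) y - H (- (`|y| + 1)) 0.
have FE (B y : R) : `|y| + 1 <= B -> F y = H (- B) y - H (- B) 0.
  move=> yB; have y0 := normr_ge0 y; have yl := lerNnormlW (lexx `|y|).
  by rewrite /F -(Hab (- B) (- (`|y| + 1)))//; lra.
exists F => x.
pose B : R := `|x| + 3.
have [Hd Hv] : derivable (H (- B)) x 1 /\ derive1 (H (- B)) x = f x.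
  apply: (@continuous_FTC1_closed R f (- B) x (x + 1)) => //.
  - by rewrite ltrDl.
  - by rewrite /B; have := lerNnormlW (lexx `|x|); lra.
  - exact: cf.
have Hx : is_derive x 1 (H (- B)) (f x).
  by split => //; rewrite -derive1E.
have := derB Hx (der_cst (H (- B) 0) x); rewrite subr0.
apply: near_eq_is_derive.
near=> y; rewrite (FE B)// /B.
have : `|x - y| <= 1.
  by near: y; apply: cvgr_dist_le => //; exact: cvg_id.
have := ler_normB x (x - y); rewrite subKr.
by lra.
Unshelve. all: by end_near. Qed.

Lemma cint_shift f x : continuous f -> periodic f 1 ->
  J (fun t => f (x - t)) = J f.
Proof.
move=> cf pf; have [F dF] := continuous_primitive cf.
have dFx (t : R) : is_derive t 1 (fun t => - F (x - t)) (f (x - t)).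
  have := derN (@der_comp _ F (fun t => x - t) t _ _ (dF (x - t)) (derB (der_cst x t) (der_id t))).
  by move/der_eq; apply; rewrite sub0r mulrN1 opprK.
rewrite (cint_FTC dFx); last first.
  move=> t; apply: continuous_comp; last exact: cf.
  by apply: cvgB; [exact: cvg_cst|exact: cvg_id].
rewrite (cint_FTC dF cf) subr0 opprK.
(* F (y) - F (y - 1) is constant because f is 1-periodic. *)
pose G y := F y - F (y - 1).
have -> : - F (x - 1) + F x = G x by rewrite /G addrC.
have -> : G x = G 1; last by rewrite /G subrr.
apply: der_eq0_eq => y.
have := derB (dF y) (@der_comp _ F (fun t => t - 1) y _ _ (dF (y - 1)) (derB (der_id y) (der_cst 1 y))).
move/der_eq; apply.
by rewrite subr0 mulr1 -{1}(subrK 1 y) pf subrr.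
Qed.

Lemma cint_eq0 f : continuous f -> (forall x, 0 <= x <= 1 -> 0 <= f x) -> J f <= 0 ->
  forall x, 0 < x < 1 -> f x = 0.
Proof.
move=> cf f0 Jf x /andP[x0 x1].
have [F dF] := continuous_primitive cf.
have mono a b : 0 <= a -> a <= b -> b <= 1 -> F a <= F b.
  move=> a0 ab b1; apply: (der_ge0_le ab (fun y _ => dF y)) => y.
  by move=> /andP[ay yb]; apply: f0; rewrite (le_trans a0 (ltW ay)) (le_trans (ltW yb)).
have Fc y : 0 <= y <= 1 -> F y = F 0.
  move=> /andP[y0 y1]; apply/eqP; rewrite eq_le.
  apply/andP; split; last exact: mono.
  apply: (@le_trans _ _ (F 1)); first exact: mono.
  by rewrite -subr_le0 -(cint_FTC dF cf).
have := dF x; have : is_derive x 1 F 0.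
  apply: (near_eq_is_derive _ (der_cst (F 0) x)).
  near=> y; rewrite Fc//; apply/andP; split; apply: ltW; near: y.
  - exact: lt_nbhsr.
  - exact: lt_nbhsl.
by move=> /@derive_val <- /@derive_val <-.
Unshelve. all: by end_near. Qed.

(** Differentiation under the integral sign, with a uniform bound on the
    derivative. *)
Lemma der_cint (G dG : R -> R -> R) (u v s C : R) : u < s < v ->
  (forall s x, u < s < v -> is_derive s 1 (G ^~ x) (dG s x)) ->
  (forall s, u < s < v -> continuous (G s)) ->
  (forall s x, u < s < v -> `|dG s x| <= C) ->
  is_derive s 1 (fun s => J (G s)) (J (dG s)).
Proof.
move=> suv GdG cG dGC.
have sI : `]u, v[%classic s by rewrite /= in_itv/=.
have iG y : `]u, v[%classic y -> intg (G y).
  by rewrite /= in_itv/= => /cG/cont_intg.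
have dG1 y x : `]u, v[%classic y -> I01 x -> derivable (G^~ x) y 1.
  by rewrite /= in_itv/= => /GdG => /(_ x)/der_derivable.
have C0 (y : R) : 0 <= C by apply: le_trans (dGC s 0 suv).
have bd y x : `]u, v[%classic y -> I01 x -> `|partial1of2 G y x| <= C.
  rewrite /= in_itv/= => yuv _; rewrite /partial1of2.
  by rewrite (der_derive1 (GdG _ _ yuv)) dGC.
split.
  exact: (derivable_under_integral measurable_I01 sI iG dG1 C0 (intg_cst C) bd).
rewrite -derive1E.
rewrite (differentiation_under_integral measurable_I01 sI iG dG1 C0 (intg_cst C) bd).
by apply: eq_Rintegral => x _; exact: der_derive1 (GdG _ _ suv).
Qed.

End circle_integral.


(** * The sharp Poincare inequality on the circle *)

Section wirtinger.
Context {R : realType}.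
Local Notation J := (@circle_int R).
Implicit Types (f df : R -> R) (x c w : R).

Lemma periodic_der f df : (forall x, is_derive x 1 f (df x)) ->
  periodic f 1 -> periodic df 1.
Proof.
move=> dF pf x.
have Hx := @der_comp _ f (fun t => t + 1) x _ _ (dF (x + 1))
  (derD (der_id x) (der_cst 1 x)).
have e : (fun t => f (t + 1)) = f by apply/funext => t; exact: pf.
rewrite e in Hx; have := @derive_val _ _ _ _ _ _ _ Hx.
by rewrite addr0 mulr1 => <-; have /@derive_val := dF x.
Qed.

(** On a half period at the ends of which f - c vanishes, completing the square
    against w * cot (w * (x - b) + th) bounds w ^ 2 * int (f - c) ^ 2 by
    int f' ^ 2; the phase th keeps the argument inside ]0, pi[. *)
Lemma half_period_ge0 f df (Q : R -> R) w b c : 0 < w -> w < 2 * pi ->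
  (forall x, is_derive x 1 f (df x)) ->
  (forall x, is_derive x 1 Q (df x ^+ 2 - w ^+ 2 * (f x - c) ^+ 2)) ->
  f b = c -> f (b + 2^-1) = c -> Q b <= Q (b + 2^-1).
Proof.
move=> w0 w2 dF dQ fb fb2.
pose th := (pi - w / 2) / 2.
pose arg x := w * x + (th - w * b).
have darg x : is_derive x 1 arg w by exact: der_affine.
have sin0 x : b <= x <= b + 2^-1 -> 0 < sin (arg x).
  move=> /andP[bx xb]; apply: sin_gt0_pi.
  have -> : arg x = w * (x - b) + th by rewrite /arg; ring.
  have : 0 <= w * (x - b) by rewrite mulr_ge0 ?subr_ge0// ltW.
  have : w * (x - b) <= w * 2^-1 by rewrite ler_pM2l// lerBlDl.
  by rewrite /th; lra.
pose phi x := w * (cos (arg x) / sin (arg x)).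
pose G x := Q x - (f x - c) ^+ 2 * phi x.
have -> : Q b = G b by rewrite /G fb subrr expr0n/= mul0r subr0.
have -> : Q (b + 2^-1) = G (b + 2^-1) by rewrite /G fb2 subrr expr0n/= mul0r subr0.
apply: (@der_ge0_le _ _ (fun x => (df x - (f x - c) * phi x) ^+ 2)).
- by rewrite lerDl.
- move=> x xb; have s0 := sin0 _ xb.
  have dcos := @der_comp _ _ arg x _ _ (is_derive_cos (arg x)) (darg x).
  have dsin := @der_comp _ _ arg x _ _ (is_derive_sin (arg x)) (darg x).
  have s1 : sin (arg x) != 0 by rewrite gt_eqF.
  have dphi := derZ w (derM dcos (derV s1 dsin)).
  have dfc := derX 2 (derB (dF x) (der_cst c x)).
  apply: (der_eq (derB (dQ x) (derM dfc dphi))).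
  by rewrite /phi; move: (cos (arg x)) (sin (arg x)) s1 => C S s1; field.
- by move=> x _; exact: sqr_ge0.
Qed.

Theorem wirtinger f df : (forall x, is_derive x 1 f (df x)) -> continuous df ->
  periodic f 1 -> J f = 0 ->
  (2 * pi) ^+ 2 * J (fun x => f x ^+ 2) <= J (fun x => df x ^+ 2).
Proof.
move=> dF cdf pf Jf0.
have cf := der_continuous dF.
have pdf := periodic_der dF pf.
(* f (x + 1/2) - f x takes opposite values at 0 and 1/2. *)
have [a fa] : exists a, f (a + 2^-1) = f a.
  pose g x := f (x + 2^-1) - f x.
  have cg : continuous g.
    apply: contB => //; apply: cont_comp => //.
    by apply: contD; [move=> x; exact: cvg_id|exact: cont_cst].
  have g2 : g (2^-1) = - g 0.
    rewrite /g add0r opprB; congr (_ - _).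
    by rewrite -(pf 0); congr f; lra.
  have [|||x _ gx] := @IVT R g 0 2^-1 0.
  - by rewrite invr_ge0.
  - exact: continuous_subspaceT.
  - by rewrite g2 ge_min le_max oppr_ge0 oppr_le0; apply/andP; split; case: ltP => // /ltW.
  - by exists x; apply/eqP; rewrite -subr_eq0; apply/eqP.
pose c := f a.
(* f has mean zero, so subtracting a constant increases the L2 norm. *)
have Jfc : J (fun x => f x ^+ 2) <= J (fun x => (f x - c) ^+ 2).
  have -> : (fun x => (f x - c) ^+ 2) =
            (fun x => (f x ^+ 2 - (2 * c) * f x) + c ^+ 2).
    by apply/funext => x; ring.
  have i1 := cont_intg (contX 2 cf); have i2 := intgZ (2 * c) (cont_intg cf).
  rewrite (cintD (intgB i1 i2) (intg_cst _)) (cintB i1 i2).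
  by rewrite (cintZ _ (cont_intg cf)) Jf0 cint_cst mulr0 subr0 lerDl sqr_ge0.
(* The calibration needs w < 2 pi; the limit w -> 2 pi is taken last. *)
have key w : 0 < w -> w < 2 * pi ->
    w ^+ 2 * J (fun x => f x ^+ 2) <= J (fun x => df x ^+ 2).
  move=> w0 w2.
  apply: (@le_trans _ _ (w ^+ 2 * J (fun x => (f x - c) ^+ 2))).
    by rewrite ler_wpM2l// sqr_ge0.
  have ic := cont_intg (contX 2 (contB cf (@cont_cst R c))).
  have id := cont_intg (contX 2 cdf).
  rewrite -cintZ// -subr_ge0 -cintB//; last exact: intgZ.
  pose h x := df x ^+ 2 - w ^+ 2 * (f x - c) ^+ 2.
  have ch : continuous h.
    by apply: contB; [exact: contX|apply: contZ; apply: contX; apply: contB => //; exact: cont_cst].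
  have [Q dQ] := continuous_primitive ch.
  rewrite (cint_FTC dQ ch).
  have ph : periodic h 1 by move=> x; rewrite /h pf pdf.
  pose G x := Q (x + 1) - Q x.
  have GE : G 0 = G a.
    apply: der_eq0_eq => x.
    have := derB (@der_comp _ Q (fun t => t + 1) x _ _ (dQ (x + 1))
       (derD (der_id x) (der_cst 1 x))) (dQ x).
    by move/der_eq; apply; rewrite ph addr0 mulr1 subrr.
  have -> : Q 1 - Q 0 = G a by rewrite -GE /G add0r.
  have fa1 : f (a + 2^-1 + 2^-1) = c.
    by rewrite /c -(pf a); congr f; lra.
  have h1 := half_period_ge0 w0 w2 dF dQ (erefl c) fa.
  have h2 := half_period_ge0 w0 w2 dF dQ fa fa1.
  rewrite /G subr_ge0 (le_trans h1)// (le_trans h2)//.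
  by rewrite le_eqVlt; apply/orP; left; apply/eqP; congr Q; lra.
have B0 : 0 <= J (fun x => f x ^+ 2) by apply: cint_ge0 => x _; exact: sqr_ge0.
move: key B0; move: (J _) (J _) => C B key B0.
have p0 : (0 : R) < pi := pi_gt0 R.
rewrite leNgt; apply/negP => CB.
have [B00|Bp] := leP B 0.
  have B0E : B = 0 by apply/le_anti/andP.
  have := key pi p0 ltac:(lra); move: CB.
  by rewrite B0E !mulr0 => /lt_le_trans H /H; rewrite ltxx.
have d0 : 0 < (2 * pi) ^+ 2 * B - C by rewrite subr_gt0.
pose e := Num.min pi (((2 * pi) ^+ 2 * B - C) / (8 * pi * B)).
have e0 : 0 < e by rewrite lt_min p0 divr_gt0// !mulr_gt0.
have ep : e <= pi by rewrite ge_min lexx.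
have eB : e * (8 * pi * B) <= (2 * pi) ^+ 2 * B - C.
  by rewrite -ler_pdivlMr ?mulr_gt0// ge_min lexx orbT.
have := key (2 * pi - e); rewrite subr_gt0 gtrBl => /(_ _ e0)H.
have {}H := H ltac:(lra).
have : 0 <= e ^+ 2 * B by rewrite mulr_ge0 ?sqr_ge0// ltW.
nra.
Qed.

End wirtinger.

(** * Trigonometric polynomials and their heat extension *)

Section trig_polynomials.
Context {R : realType}.
Local Notation J := (@circle_int R).
Local Notation term := (R * R * int)%type.
Implicit Types (l : seq term) (i : term) (s x : R).

(** The term (a, th, k) stands for the function a cos (2 pi k x + th); a list of
    terms stands for their sum, and frequencies may be repeated. *)
Definition tval i x : R := i.1.1 * cos ((2 * pi * i.2%:~R) * x + i.1.2).

Definition trig l x : R := \sum_(i <- l) tval i x.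

(** The derivatives of a term and of a list of terms. *)
Definition dterm i : term := (2 * pi * i.2%:~R * i.1.1, i.1.2 + pi / 2, i.2).

Definition dtrig l : seq term := map dterm l.

(** The square of the frequency, the exponent of s in the heat extension. *)
Definition freq2 i : nat := (`|i.2|%N ^ 2)%N.

(** With s = exp (- 4 pi^2 t), [heat l s] is the solution at time t of the heat
    equation on the circle starting from [trig l]; in this variable the flow is
    polynomial and its limit as t goes to infinity is reached at s = 0. *)
Definition heat l s x : R := \sum_(i <- l) s ^+ freq2 i * tval i x.

(** The derivative of [heat l s x] with respect to s. *)
Definition heats l s x : R :=
  \sum_(i <- l) ((freq2 i)%:R * s ^+ (freq2 i).-1) * tval i x.

Lemma tval_der i x : is_derive x 1 (tval i) (tval (dterm i) x).
Proof.
have d := @der_comp _ cos _ x _ _ (is_derive_cos _)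
  (der_affine (2 * pi * i.2%:~R) i.1.2 x).
apply: (der_eq (derZ i.1.1 d)).
rewrite /tval /dterm /= addrA cosDpihalf; ring.
Qed.

Lemma tval_dterm2 i x :
  tval (dterm (dterm i)) x = - (2 * pi) ^+ 2 * (freq2 i)%:R * tval i x.
Proof.
have -> : (freq2 i)%:R = (i.2%:~R : R) ^+ 2.
  by rewrite /freq2 natrX natr_absz intr_norm real_normK ?num_real.
have arg : forall a b : R, a + (b + pi / 2 + pi / 2) = (a + b) + pi by move=> a b; field.
by rewrite /tval /dterm /= arg cosDpi; ring.
Qed.

Lemma trig_der l x : is_derive x 1 (trig l) (trig (dtrig l) x).
Proof.
rewrite /trig /dtrig big_map.
by apply: (@der_sum _ _ l tval (fun i y => tval (dterm i) y)) => i; exact: tval_der.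
Qed.

Lemma heat_derx l s x : is_derive x 1 (heat l s) (heat (dtrig l) s x).
Proof.
rewrite /heat /dtrig big_map.
by apply: (@der_sum _ _ l (fun i x => s ^+ freq2 i * tval i x)
  (fun i x => s ^+ freq2 i * tval (dterm i) x)) => i;
  apply: derZ; exact: tval_der.
Qed.

Lemma heat_ders l s x : is_derive s 1 (heat l ^~ x) (heats l s x).
Proof.
apply: (@der_sum _ _ l (fun i s => s ^+ freq2 i * tval i x)
  (fun i s => (freq2 i)%:R * s ^+ (freq2 i).-1 * tval i x)) => i.
have := derM (derX (freq2 i) (der_id s)) (der_cst (tval i x) s).
by move/der_eq; apply; rewrite mulr0 addr0 mulr1.
Qed.

(** The heat equation, in the variable s. *)
Lemma heats_eq l s x : (2 * pi) ^+ 2 * (s * heats l s x) = - heat (dtrig (dtrig l)) s x.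
Proof.
rewrite /heats /heat /dtrig !big_map -sumrN !mulr_sumr.
apply: eq_bigr => i _.
rewrite tval_dterm2 (_ : freq2 (dterm (dterm i)) = freq2 i)//.
move: (tval i x) (freq2 i) => v; case=> [|n]; first by ring.
by rewrite [n.+1.-1]/= [s ^+ n.+1]exprS; ring.
Qed.

Lemma heats_dtrig l s x : is_derive x 1 (heats l s) (heats (dtrig l) s x).
Proof.
rewrite /heats /dtrig big_map.
by apply: (@der_sum _ _ l (fun i x => ((freq2 i)%:R * s ^+ (freq2 i).-1) * tval i x)
  (fun i x => ((freq2 i)%:R * s ^+ (freq2 i).-1) * tval (dterm i) x)) => i;
  apply: derZ; exact: tval_der.
Qed.

Lemma trig_cont l : continuous (trig l).
Proof. exact: der_continuous (trig_der l). Qed.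

Lemma heat_cont l s : continuous (heat l s).
Proof. exact: der_continuous (heat_derx l s). Qed.

Lemma heats_cont l s : continuous (heats l s).
Proof. exact: der_continuous (heats_dtrig l s). Qed.

Lemma cos_period (k : int) x : cos (x + 2 * pi * k%:~R) = cos x :> R.
Proof.
have P (n : nat) (y : R) : cos (y + 2 * pi * n%:R) = cos y.
  rewrite -(periodicn (@cosD2pi R) n y); congr (cos (_ + _)).
  by rewrite -[RHS]mulr_natr -[pi *+ 2]mulr_natl.
case: k => n; first by rewrite -pmulrn P.
by rewrite NegzE mulrNz mulrN -(P n.+1) subrK.
Qed.

Lemma tval_periodic i x : tval i (x + 1) = tval i x.
Proof.
rewrite /tval; congr (_ * _); rewrite -(cos_period i.2 (_ * x + _)).
by congr cos; ring.
Qed.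

Lemma trig_periodic l : periodic (trig l) 1.
Proof. by move=> x; apply: eq_bigr => i _; rewrite tval_periodic. Qed.

Lemma heat_periodic l s : periodic (heat l s) 1.
Proof. by move=> x; apply: eq_bigr => i _; rewrite tval_periodic. Qed.

Lemma heat_at1 l x : heat l 1 x = trig l x.
Proof. by apply: eq_bigr => i _; rewrite expr1n mul1r. Qed.

Lemma heat_at0 l x : heat l 0 x = heat l 0 0.
Proof.
apply: eq_bigr => i _; rewrite expr0n.
have [f0|] := eqVneq (freq2 i) 0%N; last by rewrite !mul0r.
rewrite /tval; have -> : i.2 = 0.
  by move/eqP: f0; rewrite /freq2 expn_eq0 andbT absz_eq0 => /eqP.
by rewrite mulr0 !mul0r.
Qed.

Lemma tval_bound i x : `|tval i x| <= `|i.1.1|.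
Proof. by rewrite /tval normrM ler_piMr// cos_max. Qed.

Lemma heat_bound l : exists C, forall s x, `|s| <= 2 -> `|heat l s x| <= C.
Proof.
exists (\sum_(i <- l) 2 ^+ freq2 i * `|i.1.1|) => s x s2.
apply: le_trans (ler_norm_sum _ _ _) _; apply: ler_sum => i _.
rewrite normrM ler_pM// ?tval_bound// normrX.
by rewrite lerXn2r// nnegrE.
Qed.

Lemma heats_bound l : exists C, forall s x, `|s| <= 2 -> `|heats l s x| <= C.
Proof.
exists (\sum_(i <- l) ((freq2 i)%:R * 2 ^+ (freq2 i).-1) * `|i.1.1|) => s x s2.
apply: le_trans (ler_norm_sum _ _ _) _; apply: ler_sum => i _.
rewrite normrM ler_pM// ?tval_bound// normrM normrX normr_nat.
by rewrite ler_wpM2l// lerXn2r// nnegrE.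
Qed.

Lemma cint_sum (I : Type) (r : seq I) (F : I -> R -> R) :
  (forall j, (@lebesgue_measure R).-integrable `[0%R, 1%R] (EFin \o F j)) ->
  J (fun x => \sum_(j <- r) F j x) = \sum_(j <- r) J (F j).
Proof.
move=> Fi.
suff H : (@lebesgue_measure R).-integrable `[0%R, 1%R]
     (EFin \o (fun x => \sum_(j <- r) F j x)) /\
   J (fun x => \sum_(j <- r) F j x) = \sum_(j <- r) J (F j) by case: H.
elim: r => [|k r [IH1 IH2]].
  rewrite big_nil (_ : (fun x => _) = fun=> 0).
    by split; [exact: intg_cst|exact: cint_cst].
  by apply/funext => x; rewrite big_nil.
rewrite big_cons (_ : (fun x => _) = fun x => F k x + \sum_(j <- r) F j x); last first.
  by apply/funext => x; rewrite big_cons.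
by split; [exact: intgD|rewrite cintD// IH2].
Qed.

Lemma cint_tval i : J (tval i) = 0 ^+ freq2 i * tval i 0.
Proof.
have [k0|k0] := eqVneq i.2 0.
  have -> : freq2 i = 0%N by rewrite /freq2 k0.
  rewrite expr0 mul1r -[RHS]cint_cst; apply: eq_cint => x _.
  by rewrite /tval k0 mulr0 !mul0r.
have w0 : 2 * pi * i.2%:~R != 0 :> R by rewrite !mulf_neq0 ?intr_eq0// gt_eqF// pi_gt0.
have -> : freq2 i = (freq2 i).-1.+1.
  by rewrite prednK// /freq2 expn_gt0 absz_gt0 k0.
rewrite exprS !mul0r.
pose j : term := (i.1.1 / (2 * pi * i.2%:~R), i.1.2 - pi / 2, i.2).
have dj x : is_derive x 1 (tval j) (tval i x).
  apply: (der_eq (tval_der j x)); rewrite /tval /dterm/= subrK.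
  by rewrite mulrCA divff// mulr1.
rewrite (cint_FTC dj); last exact: der_continuous (tval_der i).
by rewrite -[1]add0r tval_periodic subrr.
Qed.

Lemma cint_trig l : J (trig l) = heat l 0 0.
Proof.
rewrite cint_sum; last by move=> i; apply: cont_intg; exact: der_continuous (tval_der i).
by apply: eq_bigr => i _; exact: cint_tval.
Qed.

End trig_polynomials.

(** * Positivity of the heat extension *)

Section positivity.
Context {R : realType}.
Local Notation J := (@circle_int R).
Implicit Types (s x z : R).

Lemma cint_eq0_periodic (f : R -> R) : continuous f -> periodic f 1 ->
  (forall x, 0 <= f x) -> J f <= 0 -> forall x, f x = 0.
Proof.
move=> cf pf f0 Jf x.
have cg : continuous (fun t => f (x + 2^-1 - t)).
  by apply: cont_comp => //; apply: contB; [exact: cont_cst|move=> t; exact: cvg_id].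
have H := @cint_eq0 _ _ cg (fun t _ => f0 _) _ (2^-1).
by have := H ltac:(by rewrite cint_shift) ltac:(by apply/andP; split; lra); rewrite addrK.
Qed.

(** The positive part; its cube is twice differentiable. *)
Let pos z : R := Num.max 0 z.

Let pos_ge0 z : 0 <= pos z.
Proof. by rewrite /pos le_max lexx. Qed.

Let pos_cont : continuous pos.
Proof.
by move=> z; apply: (@continuous_max _ R (cst 0) id); [exact: cvg_cst|exact: cvg_id].
Qed.

Let pos_cases z : (0 <= z /\ pos z = z) \/ (z < 0 /\ pos z = 0).
Proof.
rewrite /pos; have [z0|z0] := leP 0 z; [left|right]; split => //.
Qed.

Let pos2_der z : is_derive z 1 (fun z => pos z ^+ 2) (2 * pos z).
Proof.
apply: (@der_quad _ _ _ _ 1) => h _; rewrite mul1r ler_norml.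
case: (pos_cases z) => [[z0 ->]|[z0 ->]];
  case: (pos_cases (z + h)) => [[h0 ->]|[h0 ->]]; apply/andP; split; nra.
Qed.

Let pos3_der z : is_derive z 1 (fun z => pos z ^+ 3) (3 * pos z ^+ 2).
Proof.
apply: (@der_quad _ _ _ _ (3 * pos z + 1)) => h; rewrite !ler_norml => /andP[h1 h2].
case: (pos_cases z) => [[z0 ->]|[z0 ->]];
  case: (pos_cases (z + h)) => [[h0 ->]|[h0 ->]].
- have -> : (z + h) ^+ 3 - z ^+ 3 - 3 * z ^+ 2 * h = (3 * z + h) * h ^+ 2 by ring.
  by apply/andP; split; [rewrite -mulNr|]; apply: ler_wpM2r; rewrite ?sqr_ge0//; lra.
- have -> : 0 ^+ 3 - z ^+ 3 - 3 * z ^+ 2 * h = z ^+ 2 * (- (z + h) - 2 * h).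
    by rewrite expr0n/=; ring.
  have zz : z ^+ 2 <= h ^+ 2 by nra.
  have a1 : 0 <= z ^+ 2 * (- (z + h) - 2 * h) by rewrite mulr_ge0 ?sqr_ge0//; lra.
  have a2 : z ^+ 2 * (- (z + h) - 2 * h) <= 3 * z * h ^+ 2.
    by have : 0 <= z * (z + h) ^+ 2; [rewrite mulr_ge0 ?sqr_ge0|nra].
  have a3 := sqr_ge0 h.
  by apply/andP; split; nra.
- have -> : (z + h) ^+ 3 - 0 ^+ 3 - 3 * 0 ^+ 2 * h = (z + h) * (z + h) ^+ 2.
    by rewrite !expr0n/=; ring.
  have a1 : 0 <= (z + h) * (z + h) ^+ 2 by rewrite mulr_ge0 ?sqr_ge0.
  have a2 : (z + h) ^+ 2 <= h ^+ 2 by nra.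
  have a3 := sqr_ge0 h.
  by apply/andP; split; nra.
- by have a3 := sqr_ge0 h; rewrite !expr0n/= mulr0 !mul0r !subr0; apply/andP; split; nra.
Qed.

(** The heat flow does not lower the minimum: the energy
    int max(0, d - rho)^3, a convex function of rho, vanishes for the initial
    datum and decreases along the flow. *)
Lemma heat_ge l (d : R) : (forall x, d <= trig l x) ->
  forall s x, 0 <= s <= 1 -> d <= heat l s x.
Proof.
move=> ld s x /andP[s0 s1].
(* The s-derivative of the energy, multiplied by s, is a positive multiple of
   the integral of pos ^ 2 rho_xx, nonnegative after an integration by parts. *)
pose G s x := pos (d - heat l s x) ^+ 3.
pose dG s x := 3 * pos (d - heat l s x) ^+ 2 * - heats l s x.
have GdG (t y : R) : is_derive t 1 (G ^~ y) (dG t y).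
  apply: (@der_comp _ (fun z => pos z ^+ 3) (fun t => d - heat l t y)).
    exact: pos3_der.
  by apply: (der_eq (derB (der_cst d t) (heat_ders l t y))); rewrite sub0r.
have cpos (t : R) : continuous (fun y => pos (d - heat l t y)).
  by apply: cont_comp => //; apply: contB; [exact: cont_cst|exact: heat_cont].
have cG (t : R) : continuous (G t) by apply: contX.
have [C1 hC1] := heat_bound l.
have [C2 hC2] := heats_bound l.
have bd (t y : R) : -1 < t < 2 -> `|dG t y| <= 3 * (`|d| + C1) ^+ 2 * C2.
  move=> /andP[t1 t2]; have t3 : `|t| <= 2 by rewrite ler_norml; apply/andP; split; lra.
  have := hC1 t y t3; have := hC2 t y t3; move=> b2 b1.
  rewrite /dG normrM normrN normrM ger0_norm//.
  rewrite ler_pM ?mulr_ge0// ler_pM2l// ger0_norm ?sqr_ge0//.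
  rewrite lerXn2r ?nnegrE ?addr_ge0 ?(le_trans _ b1)//.
  rewrite /pos ge_max addr_ge0 ?(le_trans _ b1)//=.
  by have := ler_norm d; have := lerNnormlW b1; lra.
have dE (t : R) : 0 <= t <= 1 -> is_derive t 1 (fun s => J (G s)) (J (dG t)).
  move=> /andP[t0 t1].
  by apply: (@der_cint _ G dG (-1) 2 t _ _ _ _ bd) => //; apply/andP; split; lra.
have dE0 (t : R) : 0 < t < 1 -> 0 <= J (dG t).
  move=> /andP[t0 _].
  rewrite -(pmulr_rge0 _ (_ : 0 < (2 * pi) ^+ 2 * t)); last first.
    by rewrite mulr_gt0// exprn_gt0// mulr_gt0// pi_gt0.
  pose r1 := heat (dtrig l) t; pose r2 := heat (dtrig (dtrig l)) t.
  have cdG : continuous (dG t).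
    apply: contM; first by apply: contZ; exact: contX.
    by move=> y; apply: cvgN; exact: heats_cont.
  rewrite -cintZ; last exact: cont_intg.
  have -> : (fun y => (2 * pi) ^+ 2 * t * dG t y) =
      (fun y => 3 * (pos (d - heat l t y) ^+ 2 * r2 y)).
    apply/funext => y; rewrite /dG /r2 -[heat (dtrig _) t y]opprK -heats_eq; ring.
  have cr1 : continuous r1 by exact: heat_cont.
  have cr2 : continuous r2 by exact: heat_cont.
  rewrite cintZ; last by apply: cont_intg; apply: contM => //; exact: contX.
  rewrite mulr_ge0//.
  pose B y := pos (d - heat l t y) ^+ 2 * r1 y.
  have dB (y : R) : is_derive y 1 B (pos (d - heat l t y) ^+ 2 * r2 y
                              - 2 * (pos (d - heat l t y) * r1 y ^+ 2)).
    have h1 := @der_comp _ (fun z => pos z ^+ 2) (fun y => d - heat l t y) y _ _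
      (pos2_der _) (derB (der_cst d y) (heat_derx l t y)).
    apply: (der_eq (derM h1 (heat_derx (dtrig l) t y))).
    by rewrite /r1 /r2; ring.
  have c1 : continuous (fun y => pos (d - heat l t y) ^+ 2 * r2 y).
    by apply: contM => //; exact: contX.
  have c2 : continuous (fun y => 2 * (pos (d - heat l t y) * r1 y ^+ 2)).
    by apply: contZ; apply: contM => //; exact: contX.
  have := cint_FTC dB (contB c1 c2).
  rewrite cintB; [|exact: cont_intg..].
  have -> : B 1 = B 0.
    by rewrite /B /r1 -[1]add0r !heat_periodic.
  rewrite subrr => /eqP; rewrite subr_eq0 => /eqP ->.
  by apply: cint_ge0 => y _; rewrite mulr_ge0// mulr_ge0// sqr_ge0.
have G1 : J (G 1) = 0.
  rewrite -[RHS]cint_cst; apply: eq_cint => y _.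
  by rewrite /G heat_at1 /pos max_l ?expr0n// subr_le0.
have Gs : J (G s) <= 0.
  rewrite -G1; apply: (@der_ge0_le _ (fun s => J (G s)) (fun s => J (dG s))) => //.
  - by move=> t /andP[st t1]; apply: dE; rewrite t1 andbT (le_trans s0).
  - by move=> t /andP[st t1]; apply: dE0; rewrite t1 andbT (le_lt_trans s0).
have pG : periodic (G s) 1 by move=> y; rewrite /G heat_periodic.
have := cint_eq0_periodic (cG s) pG _ Gs x.
rewrite /G => /(_ (fun y => exprn_ge0 _ (pos_ge0 _)))/eqP.
rewrite expf_eq0/= => /eqP p0; rewrite -subr_le0 -p0.
by rewrite /pos le_max lexx orbT.
Qed.

End positivity.

(** * The improved inequality for positive trigonometric polynomials *)

Section powers.
Context {R : realType}.
Implicit Types (x a c : R) (f : R -> R).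

Lemma powRB1 x a : 0 < x -> x `^ (a - 1) = x `^ a / x.
Proof.
move=> x0; rewrite powRD; last by rewrite (gt_eqF x0) implybT.
by rewrite -powR_inv1// ltW.
Qed.

Lemma der_powR c f x a : 0 < f x -> is_derive x 1 f a ->
  is_derive x 1 (fun y => f y `^ c) (c * f x `^ c * (a / f x)).
Proof.
move=> f0 fa.
apply: (der_eq (@der_comp _ (fun y => y `^ c) f x _ _ (is_derive1_powR c f0) fa)).
by rewrite powRB1//; ring.
Qed.

Lemma cont_powR c f : continuous f -> (forall x, 0 < f x) ->
  continuous (fun x => f x `^ c).
Proof.
move=> cf f0 x; apply: (@continuous_comp _ _ _ f (fun y => y `^ c)).
  exact: cf.
exact: (der_cont (is_derive1_powR c (f0 x))).
Qed.

End powers.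

Section entropy_production.
Context {R : realType}.
Local Notation J := (@circle_int R).
Implicit Types x : R.
Variables (p : R) (r r1 r2 r3 : R -> R).
Hypotheses (dr : forall x, is_derive x 1 r (r1 x))
  (dr1 : forall x, is_derive x 1 r1 (r2 x))
  (dr2 : forall x, is_derive x 1 r2 (r3 x))
  (cr3 : continuous r3) (pr : periodic r 1) (r0 : forall x, 0 < r x).

Let cr := der_continuous dr.
Let cr1 := der_continuous dr1.
Let cr2 := der_continuous dr2.
Let pr1 := periodic_der dr pr.
Let pr2 := periodic_der dr1 pr1.
Let rn0 x : r x != 0. Proof. by rewrite gt_eqF. Qed.
Let crV : continuous (fun x => (r x)^-1). Proof. exact: contV. Qed.
Let E x := r x `^ (2 * p).
Let cE : continuous E. Proof. exact: cont_powR. Qed.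
Let pE : periodic E 1. Proof. by move=> x; rewrite /E pr. Qed.
Let E0 x : 0 < E x. Proof. exact: powR_gt0. Qed.
Let dE x : is_derive x 1 E (2 * p * E x * (r1 x / r x)).
Proof. exact: der_powR. Qed.
Let drV x := derV (rn0 x) (dr x).

(** The quantities below are written in terms of a density r; for u = r ^ p
    they are the integrals of u ^ 2, u' ^ 2 / p ^ 2 and u' ^ 4 / (p ^ 4 u ^ 2). *)
Let A := J E.
Let K := J (fun x => E x * r1 x ^+ 2 / r x ^+ 2).
Let B4 := J (fun x => E x * r1 x ^+ 4 / r x ^+ 4).

Let cVn n : continuous (fun x => (r x ^+ n)^-1).
Proof. by under eq_fun do rewrite -exprVn; exact: contX. Qed.

Let cK : continuous (fun x => E x * r1 x ^+ 2 / r x ^+ 2).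
Proof. by apply: contM => //; apply: contM => //; exact: contX. Qed.

Let cB4 : continuous (fun x => E x * r1 x ^+ 4 / r x ^+ 4).
Proof. by apply: contM => //; apply: contM => //; exact: contX. Qed.

Lemma cint_exact (B b : R -> R) : (forall x, is_derive x 1 B (b x)) -> continuous b ->
  periodic B 1 -> J b = 0.
Proof. by move=> dB cb pB; rewrite (cint_FTC dB cb) -[1]add0r pB subrr. Qed.

Lemma entropy_dissipation : J (fun x => E x * r2 x / r x) = (1 - 2 * p) * K.
Proof.
have cE2 : continuous (fun x => E x * r2 x / r x).
  by apply: contM => //; exact: contM.
have cb : continuous (fun x => E x * r2 x / r x - (1 - 2 * p) * (E x * r1 x ^+ 2 / r x ^+ 2)).
  by apply: contB => //; exact: contZ.
have := @cint_exact (fun x => E x * r1 x * (r x)^-1) _ _ cb _.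
rewrite cintB; [|exact: cont_intg|by apply: intgZ; exact: cont_intg].
rewrite cintZ; last exact: cont_intg.
move=> H; apply/eqP; rewrite -subr_eq0; apply/eqP/H.
- move=> x; apply: (der_eq (derM (derM (dE x) (dr1 x)) (drV x))).
  by move: (rn0 x) => rx; field.
- by move=> x; rewrite pE pr pr1.
Qed.

(** The Cauchy-Schwarz inequality, from the nonnegativity of the integral of
    E (r'^2 / r^2 - t)^2 at t = K / A. *)
Let B4_ge : K ^+ 2 <= B4 * A.
Proof.
have A0 : 0 <= A by apply: cint_ge0 => x _; exact: ltW.
have key t : 0 <= B4 - (2 * t * K - t ^+ 2 * A).
  have -> : B4 - (2 * t * K - t ^+ 2 * A) =
      J (fun x => E x * (r1 x ^+ 2 / r x ^+ 2 - t) ^+ 2).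
    have -> : (fun x => E x * (r1 x ^+ 2 / r x ^+ 2 - t) ^+ 2) =
       (fun x => E x * r1 x ^+ 4 / r x ^+ 4 -
         ((2 * t) * (E x * r1 x ^+ 2 / r x ^+ 2) - t ^+ 2 * E x)).
      by apply/funext => x; move: (rn0 x) => rx; field.
    have i1 := intgZ (2 * t) (cont_intg cK); have i2 := intgZ (t ^+ 2) (cont_intg cE).
    rewrite (cintB (cont_intg cB4) (intgB i1 i2)) (cintB i1 i2).
    by rewrite (cintZ _ (cont_intg cK)) (cintZ _ (cont_intg cE)).
  by apply: cint_ge0 => x _; rewrite mulr_ge0 ?sqr_ge0// ltW.
have [A00|A00] := eqVneq A 0.
  have K0 : K = 0.
    apply/eqP/negP => /negP K0; have := key ((B4 + 1) / (2 * K)).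
    rewrite A00 mulr0 subr0 => h; have e : 2 * ((B4 + 1) / (2 * K)) * K = B4 + 1 by field.
    by move: h; rewrite e; lra.
  by rewrite K0 A00 expr0n mulr0.
have Ap : 0 < A by rewrite lt_def A00.
have := key (K / A).
have -> : B4 - (2 * (K / A) * K - (K / A) ^+ 2 * A) = (B4 * A - K ^+ 2) / A by field.
by rewrite pmulr_lge0 ?invr_gt0// subr_ge0.
Qed.

(** The Bakry-Emery computation: along the flow r_t = r'' the derivative of K is
    the integral on the right-hand side. After integration by parts its opposite
    is twice the integral of the square of the derivative of r ^ p r' / r,
    bounded below by the Poincare inequality, plus a multiple of B4. *)
Lemma fisher_dissipation : 0 < p -> p < 1 ->
  2 * (2 * pi) ^+ 2 * K * A + 2 / 3 * p * (1 - p) * K ^+ 2 <=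
  - J (fun x => (2 * p - 2) * E x * r1 x ^+ 2 * r2 x / r x ^+ 3 +
                2 * E x * r1 x * r3 x / r x ^+ 2) * A.
Proof.
move=> p0 p1.
pose e x := r x `^ p.
have eE x : E x = e x ^+ 2.
  by rewrite /E /e -powR_mulrn ?powR_ge0// -powRrM mulrC.
have de x : is_derive x 1 e (p * e x * (r1 x / r x)) by exact: der_powR.
have ce : continuous e by exact: cont_powR.
pose f x := e x * r1 x * (r x)^-1.
pose df x := e x * (r2 x / r x + (p - 1) * (r1 x ^+ 2 / r x ^+ 2)).
have dF x : is_derive x 1 f (df x).
  apply: (der_eq (derM (derM (de x) (dr1 x)) (drV x))).
  by rewrite /df; move: (rn0 x) => rx; field.
have cdf : continuous df.
  apply: contM => //; apply: contD; first exact: contM.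
  by apply: contZ; apply: contM => //; exact: contX.
have pf : periodic f 1 by move=> x; rewrite /f /e pr pr1.
have Jf : J f = 0.
  have dpe x : is_derive x 1 (fun x => p^-1 * e x) (f x).
    apply: (der_eq (derZ p^-1 (de x))); rewrite /f; move: (rn0 x) => rx.
    by field; rewrite rx gt_eqF.
  apply: (cint_exact dpe (der_continuous dF)).
  by move=> x; rewrite /e pr.
have := wirtinger dF cdf pf Jf.
have -> : J (fun x => f x ^+ 2) = K.
  by apply: eq_cint => x _; rewrite /f eE; move: (rn0 x) => rx; field.
set F2 := J (fun x => df x ^+ 2) => W.
set H := J (fun x => _ + _).
have HE : H = - (2 * F2 + 2 / 3 * p * (1 - p) * B4).
  (* The boundary term whose derivative realises all integrations by parts. *)
  pose B x := E x * (2 * (r1 x * r2 x) * (r x ^+ 2)^-1 +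
                     (2 * p - 2) / 3 * r1 x ^+ 3 * (r x ^+ 3)^-1).
  pose h x := (2 * p - 2) * E x * r1 x ^+ 2 * r2 x / r x ^+ 3 +
                2 * E x * r1 x * r3 x / r x ^+ 2.
  have ch : continuous h.
    apply: contD; apply: contM => //; apply: contM => //.
    - by apply: contM; [exact: contZ|exact: contX].
    - by apply: contM => //; exact: contZ.
  have cb4 : continuous (fun x => 2 / 3 * p * (1 - p) * (E x * r1 x ^+ 4 / r x ^+ 4)).
    exact: contZ.
  have cf2 : continuous (fun x => 2 * df x ^+ 2) by apply: contZ; exact: contX.
  have cs := contD cf2 cb4.
  have rXn n x : r x ^+ n != 0 by rewrite expf_neq0.
  have dB x : is_derive x 1 B (h x + (2 * df x ^+ 2 +
      2 / 3 * p * (1 - p) * (E x * r1 x ^+ 4 / r x ^+ 4))).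
    have d1 := derM (derZ 2 (derM (dr1 x) (dr2 x))) (@derV _ (fun x => r x ^+ 2) x _ (rXn 2 x) (derX 2 (dr x))).
    have d2 := derM (derZ ((2 * p - 2) / 3) (derX 3 (dr1 x)))
       (@derV _ (fun x => r x ^+ 3) x _ (rXn 3 x) (derX 3 (dr x))).
    apply: (der_eq (derM (dE x) (derD d1 d2))).
    by rewrite /h /df eE; move: (rn0 x) => rx /=; field.
  have pB : periodic B 1 by move=> x; rewrite /B pE pr pr1 pr2.
  have := cint_exact dB (contD ch cs) pB.
  rewrite (cintD (cont_intg ch) (cont_intg cs)).
  rewrite (cintD (cont_intg cf2) (cont_intg cb4)) (cintZ _ (cont_intg cB4)).
  rewrite cintZ; last by apply: cont_intg; exact: contX.
  by move=> /eqP; rewrite addr_eq0 => /eqP.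
have A0 : 0 <= A by apply: cint_ge0 => x _; exact: ltW.
rewrite HE opprK [leRHS]mulrDl; apply: lerD.
- by apply: ler_wpM2r => //; rewrite -mulrA ler_pM2l.
- by rewrite -[leRHS]mulrA ler_wpM2l// ?B4_ge// !mulr_ge0 ?divr_ge0// ltW// subr_gt0.
Qed.

End entropy_production.

Section heat_flow.
Context {R : realType}.
Local Notation J := (@circle_int R).
Implicit Types s t x y : R.
Variables (p d : R) (l : seq (R * R * int)).
Hypotheses (p0 : 0 < p) (p2 : 2 * p < 1) (d0 : 0 < d) (ld : forall x, d <= trig l x).

Let heat_lip : exists2 C, 0 < C & forall s t x, `|s| <= 2 -> `|t| <= 2 ->
  heat l t x - C * `|s - t| <= heat l s x.
Proof.
have [C hC] := heats_bound l.
have C0 : 0 <= C by apply: le_trans (hC 0 0 _); rewrite ?normr0.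
exists (C + 1); first by rewrite ltr_wpDl.
move=> s t x; rewrite !ler_norml => /andP[s1 s2] /andP[t1 t2].
have aff (y : R) : is_derive y 1 (fun y => (C + 1) * y) (C + 1).
  by have := der_affine (C + 1) 0 y; under eq_fun do rewrite addr0.
have hC' y : -2 <= y <= 2 -> - C <= heats l y x <= C.
  by move=> y2; rewrite -ler_norml; apply: hC; rewrite ler_norml.
have [st|ts] := leP s t.
  rewrite ler0_norm ?subr_le0//.
  have H : (C + 1) * s - heat l s x <= (C + 1) * t - heat l t x.
    apply: (@der_ge0_le _ (fun y => (C + 1) * y - heat l y x) _ s t st
      (fun y _ => derB (aff y) (heat_ders l y x))) => y /andP[sy yt].
    have /hC'/andP[_] : -2 <= y <= 2 by apply/andP; split; lra.
    lra.
  nra.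
rewrite gtr0_norm ?subr_gt0//.
have H : (C + 1) * t + heat l t x <= (C + 1) * s + heat l s x.
  apply: (@der_ge0_le _ (fun y => (C + 1) * y + heat l y x) _ t s (ltW ts)
    (fun y _ => derD (aff y) (heat_ders l y x))) => y /andP[ty ys].
  have /hC'/andP[+ _] : -2 <= y <= 2 by apply/andP; split; lra.
  lra.
nra.
Qed.

(** The heat extension stays positive slightly beyond [0, 1], so that all
    quantities are differentiable up to the end points s = 0 and s = 1. *)
Lemma heat_gt0_extends : exists2 h : R, 0 < h <= 1 &
  forall s x, - h < s < 1 + h -> d / 2 <= heat l s x.
Proof.
have [C C0 hC] := heat_lip.
pose h := Num.min 1 (d / (2 * C)).
have h0 : 0 < h by rewrite lt_min ltr01 divr_gt0// mulr_gt0.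
have h1 : h <= 1 by rewrite ge_min lexx.
have hd : C * h <= d / 2.
  rewrite mulrC -ler_pdivlMr//; apply: le_trans (_ : d / (2 * C) <= _).
    by rewrite ge_min lexx orbT.
  by rewrite invfM mulrA.
exists h; first by rewrite h0.
move=> s x /andP[hs sh].
have s2 : `|s| <= 2 by rewrite ler_norml; apply/andP; split; lra.
have step t : 0 <= t <= 1 -> `|s - t| <= h -> d / 2 <= heat l s x.
  move=> t01 st.
  have t2 : `|t| <= 2 by case/andP: t01 => ? ?; rewrite ler_norml; apply/andP; split; lra.
  have := hC s t x s2 t2; have := heat_ge ld x t01.
  have : C * `|s - t| <= C * h by rewrite ler_pM2l.
  lra.
have [s0|s0] := leP s 0.
  by apply: (step 0); rewrite ?lexx ?ler01// subr0 ler0_norm//; lra.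
have [s1|s1] := leP s 1.
  by apply: (step s); rewrite ?subrr ?normr0 ?(ltW h0)// (ltW s0).
by apply: (step 1); rewrite ?lexx ?ler01// gtr0_norm ?subr_gt0//; lra.
Qed.

End heat_flow.

Section flow_comparison.
Context {R : realType}.
Implicit Types s t : R.
Variables (p P M h S c : R) (A K : R -> R).
Hypotheses (p0 : 0 < p) (p2 : 2 * p < 1) (P0 : 0 < P) (h0 : 0 < h).
Hypotheses (SE : S = P * p / (1 - 2 * p)) (cE : c = (1 - p) * S / (6 * (1 - 2 * p))).
Hypotheses (K0 : forall s, 0 <= K s) (A0E : A 0 = M) (K0E : K 0 = 0).
Hypothesis H : forall s, - h < s < 1 + h -> 0 < A s /\ exists dA dK : R,
  [/\ is_derive s 1 A dA, is_derive s 1 K dK,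
      P * (s * dA) = - (2 * p * (1 - 2 * p)) * K s &
      2 * P * K s * A s + 2 / 3 * p * (1 - p) * K s ^+ 2 <= P * (s * dK) * A s].

(** The deficit D = p^2 K - S (M - A) vanishes at s = 0 and increases with s;
    its growth rate, of order K^2 / A, also dominates that of (M - A)^2 / M
    because K is at least S (M - A) / p^2. *)
Lemma flow_comparison :
  A 1 <= M /\ S * (M - A 1) * M + c * (M - A 1) ^+ 2 <= p ^+ 2 * K 1 * M.
Proof.
have q0 : 0 < 1 - 2 * p by rewrite subr_gt0.
have p1 : 0 < 1 - p by move: p0 p2; lra.
have S0 : 0 < S by rewrite SE divr_gt0// mulr_gt0.
have inU s : 0 <= s <= 1 -> - h < s < 1 + h.
  by move=> /andP[s0 s1]; rewrite (lt_le_trans _ s0) ?oppr_lt0// (le_lt_trans s1)// ltrDl.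
have Ap s : 0 <= s <= 1 -> 0 < A s by move=> /inU/H[].
have dA s : 0 <= s <= 1 -> is_derive s 1 A (derive1 A s).
  move=> /inU/H[_ [dA [dK [h1 _ _ _]]]].
  by apply: (der_eq h1); rewrite (der_derive1 h1).
have dK s : 0 <= s <= 1 -> is_derive s 1 K (derive1 K s).
  move=> /inU/H[_ [dA' [dK [_ h1 _ _]]]].
  by apply: (der_eq h1); rewrite (der_derive1 h1).
have eA s : 0 <= s <= 1 ->
    P * (s * derive1 A s) = - (2 * p * (1 - 2 * p)) * K s.
  by move=> /inU/H[_ [dA' [dK' [h1 _ + _]]]]; rewrite (der_derive1 h1).
have eK s : 0 <= s <= 1 ->
    2 * P * K s * A s + 2 / 3 * p * (1 - p) * K s ^+ 2 <=
    P * (s * derive1 K s) * A s.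
  by move=> /inU/H[_ [dA' [dK' [_ h1 _ +]]]]; rewrite (der_derive1 h1).
have lt01W s : 0 < s < 1 -> 0 <= s <= 1 by move=> /andP[/ltW-> /ltW->].
have Ale s : 0 <= s <= 1 -> A s <= M.
  move=> /andP[s0 s1]; rewrite -A0E -lerN2.
  apply: (@der_ge0_le _ (fun s => - A s) (fun s => - derive1 A s)) => //.
  - by move=> t /andP[t0 ts]; apply: derN; apply: dA; rewrite t0 (le_trans ts).
  - move=> t /andP[t0 ts]; have t01 : 0 <= t <= 1 by rewrite ltW// (le_trans (ltW ts)).
    rewrite -(pmulr_rge0 _ (mulr_gt0 P0 t0)) mulrN -mulrA eA// mulNr opprK.
    by rewrite mulr_ge0// !mulr_ge0// ltW.
have M0 : 0 < M by rewrite -A0E; apply: Ap; rewrite lexx ler01.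
pose D s := p ^+ 2 * K s - S * (M - A s).
have dD s : 0 <= s <= 1 -> is_derive s 1 D (p ^+ 2 * derive1 K s - S * (0 - derive1 A s)).
  move=> s01; exact: (derB (derZ (p ^+ 2) (dK s s01))
    (derZ S (derB (der_cst M s) (dA s s01)))).
have Dprod s : 0 < s < 1 -> p ^+ 2 * (2 / 3 * p * (1 - p)) * (K s ^+ 2 / A s) <=
    P * s * (p ^+ 2 * derive1 K s - S * (0 - derive1 A s)).
  move=> s01; have s01' := lt01W _ s01.
  have As := Ap _ s01'.
  have -> : P * s * (p ^+ 2 * derive1 K s - S * (0 - derive1 A s)) =
     p ^+ 2 * (P * (s * derive1 K s)) + S * (P * (s * derive1 A s)).
    ring.
  rewrite eA//.
  have : 2 * P * K s + 2 / 3 * p * (1 - p) * (K s ^+ 2 / A s) <=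
      P * (s * derive1 K s).
    have := eK _ s01'; rewrite -ler_pdivrMr//; apply: le_trans.
    by rewrite le_eqVlt; apply/orP; left; apply/eqP; field; rewrite gt_eqF.
  rewrite -(ler_pM2l (exprn_gt0 2 p0)) mulrDr => W.
  have -> : S * (- (2 * p * (1 - 2 * p)) * K s) = - (p ^+ 2 * (2 * P * K s)).
    by rewrite SE; field; rewrite gt_eqF.
  rewrite lerBrDl; apply: le_trans W.
  by rewrite le_eqVlt; apply/orP; left; apply/eqP; ring.
have D0E : D 0 = 0 by rewrite /D K0E A0E subrr !mulr0 subr0.
have Dge0 s : 0 <= s <= 1 -> 0 <= D s.
  move=> /andP[s0 s1]; rewrite -D0E.
  apply: (@der_ge0_le _ D (fun s => p ^+ 2 * derive1 K s - S * (0 - derive1 A s))) => //.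
  - by move=> t /andP[t0 ts]; apply: dD; rewrite t0 (le_trans ts).
  - move=> t /andP[t0 ts]; have t01 : 0 < t < 1 by rewrite t0 (lt_le_trans ts).
    rewrite -(pmulr_rge0 _ (mulr_gt0 P0 t0)); apply: le_trans (Dprod _ t01).
    rewrite mulr_ge0 ?divr_ge0 ?sqr_ge0 ?(ltW (Ap _ _)) ?lt01W//.
    by rewrite mulr_ge0 ?sqr_ge0// ?mulr_ge0// ltW.
have one01 : 0 <= (1 : R) <= 1 by rewrite ler01 lexx.
split; first by exact: Ale.
pose Phi s := D s - (c / M) * (M - A s) ^+ 2.
have dPhi s : 0 <= s <= 1 -> is_derive s 1 Phi
   ((p ^+ 2 * derive1 K s - S * (0 - derive1 A s)) -
    (c / M) * (2 * (M - A s) * (0 - derive1 A s))).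
  move=> s01; exact: (derB (dD s s01) (derZ (c / M)
    (derX 2 (derB (der_cst M s) (dA s s01))))).
have : Phi 0 <= Phi 1.
  apply: (der_ge0_le ler01 dPhi) => t t01; have t01' := lt01W _ t01.
  have t0 : 0 < t by case/andP: t01.
  rewrite -(pmulr_rge0 _ (mulr_gt0 P0 t0)) mulrBr subr_ge0.
  apply: le_trans (Dprod _ t01).
  have -> : P * t * (c / M * (2 * (M - A t) * (0 - derive1 A t))) =
     - (c / M * (2 * (M - A t))) * (P * (t * derive1 A t)) by ring.
  rewrite eA//.
  have At := Ap _ t01'; have AM := Ale _ t01'; have Dt := Dge0 _ t01'.
  have Kt := K0 t.
  have -> : - (c / M * (2 * (M - A t))) * (- (2 * p * (1 - 2 * p)) * K t) =
     (2 / 3 * p * (1 - p)) * (K t * (S * (M - A t) / M)).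
    by rewrite cE; field; rewrite !gt_eqF.
  have -> : p ^+ 2 * (2 / 3 * p * (1 - p)) * (K t ^+ 2 / A t) =
     (2 / 3 * p * (1 - p)) * (K t * (p ^+ 2 * K t / A t)) by ring.
  rewrite ler_pM2l; last by rewrite !mulr_gt0 ?invr_gt0.
  rewrite ler_wpM2l//.
  apply: (@le_trans _ _ (S * (M - A t) / A t)).
    rewrite ler_wpM2l ?mulr_ge0 ?subr_ge0 ?(ltW S0)//.
    by rewrite lef_pV2 ?posrE.
  by rewrite ler_pM2r ?invr_gt0//; rewrite -subr_ge0.
rewrite /Phi D0E A0E subrr expr0n/= mulr0 subr0 /D => Phi1.
have -> : S * (M - A 1) * M + c * (M - A 1) ^+ 2 =
  (S * (M - A 1) + c / M * (M - A 1) ^+ 2) * M by field; rewrite gt_eqF.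
by rewrite ler_pM2r//; lra.
Qed.

End flow_comparison.

Section improved_inequality.
Context {R : realType}.
Local Notation J := (@circle_int R).
Implicit Types s t x y : R.

(** For r = |u| ^ q with p = 1 / q, these are the integral of u ^ 2 and q ^ 2
    times the integral of u' ^ 2. *)
Definition mass (p : R) (r : R -> R) : R := J (fun x => r x `^ (2 * p)).

Definition fisher (p : R) (r r1 : R -> R) : R :=
  J (fun x => r x `^ (2 * p) * r1 x ^+ 2 / r x ^+ 2).

Variables (p d : R) (l : seq (R * R * int)).
Hypotheses (p0 : 0 < p) (p2 : 2 * p < 1) (d0 : 0 < d) (ld : forall x, d <= trig l x).

Let A s := mass p (heat l s).
Let K s := fisher p (heat l s) (heat (dtrig l) s).

(** The evolution of A and K along the heat flow: since s d/ds is
    - (2 pi) ^- 2 times the Laplacian, A decreases and K increases with s. *)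
Lemma heat_flow_derivatives : exists2 h : R, 0 < h &
  forall s, - h < s < 1 + h -> 0 < A s /\ exists dA dK : R,
  [/\ is_derive s 1 A dA, is_derive s 1 K dK,
      (2 * pi) ^+ 2 * (s * dA) = - (2 * p * (1 - 2 * p)) * K s &
      2 * (2 * pi) ^+ 2 * K s * A s + 2 / 3 * p * (1 - p) * K s ^+ 2 <=
      (2 * pi) ^+ 2 * (s * dK) * A s].
Proof.
have [h /andP[h0 h1] hh] := heat_gt0_extends d0 ld.
exists h => // s sI.
pose U s := - h < s < 1 + h.
have r0 t x : U t -> 0 < heat l t x.
  by move=> tU; apply: lt_le_trans (hh t x tU); rewrite divr_gt0.
have Unorm t : U t -> `|t| <= 2.
  by move=> /andP[t1 t2]; rewrite ler_norml; apply/andP; split; lra.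
(* Domination for the derivatives under the integral sign. *)
pose bnd (f : R -> R -> R) := exists C : R, forall t x, U t -> `|f t x| <= C.
have bndM f g : bnd f -> bnd g -> bnd (fun t x => f t x * g t x).
  move=> [C hC] [D hD]; exists (C * D) => t x tU.
  by rewrite normrM ler_pM ?hC ?hD.
have bndD f g : bnd f -> bnd g -> bnd (fun t x => f t x + g t x).
  move=> [C hC] [D hD]; exists (C + D) => t x tU.
  by apply: le_trans (ler_normD _ _) _; rewrite lerD ?hC ?hD.
have bndC (c : R) : bnd (fun _ _ => c) by exists `|c|.
have bndX n f : bnd f -> bnd (fun t x => f t x ^+ n).
  move=> bf; elim: n => [|n IH].
    by under eq_fun do under eq_fun do rewrite expr0; exact: bndC.
  by under eq_fun do under eq_fun do rewrite exprS; exact: bndM.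
have bndh m : bnd (heat m).
  by have [C hC] := heat_bound m; exists C => t x /Unorm; exact: hC.
have bndhs m : bnd (heats m).
  by have [C hC] := heats_bound m; exists C => t x /Unorm; exact: hC.
have bndV : bnd (fun t x => (heat l t x)^-1).
  exists (d / 2)^-1 => t x tU.
  rewrite ger0_norm; last by rewrite invr_ge0 ltW// r0.
  by rewrite lef_pV2 ?posrE ?divr_gt0 ?r0// hh.
pose E t x := heat l t x `^ (2 * p).
have bndE : bnd E.
  have [C hC] := bndh l; exists (C `^ (2 * p)) => t x tU.
  rewrite ger0_norm ?powR_ge0// ge0_ler_powR ?nnegrE ?(ltW (r0 _ _ tU))//.
  - by rewrite mulr_ge0// ltW.
  - by apply: le_trans (hC t x tU).
  - by apply: le_trans (hC t x tU); exact: ler_norm.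
pose gA t x := 2 * p * E t x * (heats l t x * (heat l t x)^-1).
pose gK t x := (2 * p - 2) * (E t x * (heat (dtrig l) t x ^+ 2 * (heats l t x * (heat l t x)^-1 ^+ 3)))
   + 2 * (E t x * (heat (dtrig l) t x * (heats (dtrig l) t x * (heat l t x)^-1 ^+ 2))).
have [CA hCA] : bnd gA by exact: bndM _ _ (bndM _ _ (bndC (2 * p)) bndE) (bndM _ _ (bndhs l) bndV).
have [CK hCK] : bnd gK.
  have bV n := bndX n _ bndV.
  apply: bndD.
    exact: bndM _ _ (bndC _) (bndM _ _ bndE (bndM _ _ (bndX 2%N _ (bndh (dtrig l)))
      (bndM _ _ (bndhs l) (bV 3%N)))).
  exact: bndM _ _ (bndC _) (bndM _ _ bndE (bndM _ _ (bndh (dtrig l))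
      (bndM _ _ (bndhs (dtrig l)) (bV 2%N)))).
have cE t : U t -> continuous (E t).
  by move=> tU; apply: cont_powR => [|x]; [exact: heat_cont|exact: r0].
have dEs t x : U t -> is_derive t 1 (E ^~ x) (gA t x).
  move=> tU; apply: (der_eq (@der_powR _ (2 * p) (heat l ^~ x) t _ (r0 t x tU) (heat_ders l t x))).
  by [].
have cV n t : U t -> continuous (fun x => (heat l t x ^+ n)^-1).
  move=> tU; apply: contV => [|x]; first by apply: contX; exact: heat_cont.
  by rewrite expf_neq0// gt_eqF// r0.
have dA : is_derive s 1 A (J (gA s)).
  exact: (@der_cint _ E gA (- h) (1 + h) s CA).
have dK : is_derive s 1 K (J (gK s)).
  apply: (@der_cint _ (fun t x => E t x * heat (dtrig l) t x ^+ 2 / heat l t x ^+ 2)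
     gK (- h) (1 + h) s CK) => //.
    move=> t x tU.
    have rx : heat l t x != 0 by rewrite gt_eqF// r0.
    have rx2 : heat l t x ^+ 2 != 0 by rewrite expf_neq0.
    have dV := @derV _ (fun t => heat l t x ^+ 2) t _ rx2 (derX 2 (heat_ders l t x)).
    apply: (der_eq (derM (derM (dEs t x tU) (derX 2 (heat_ders (dtrig l) t x))) dV)).
    by rewrite /gA /gK /=; field.
  move=> t tU; apply: contM; last exact: cV.
  by apply: contM; [exact: cE|apply: contX; exact: heat_cont].
have rs0 x : 0 < heat l s x by exact: r0.
have A0 : 0 < A s.
  rewrite lt_def; apply/andP; split; last by apply: cint_ge0 => x _; exact: powR_ge0.
  apply/negP => /eqP A00.
  have pE : periodic (E s) 1 by move=> x; rewrite /E heat_periodic.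
  have As : J (E s) <= 0 by rewrite -[leRHS]A00.
  have := cint_eq0_periodic (cE s sI) pE (fun x => powR_ge0 _ _) As 0.
  by move/eqP; rewrite gt_eqF// powR_gt0.
split=> //; exists (J (gA s)), (J (gK s)).
have P (m : seq (R * R * int)) x : (2 * pi) ^+ 2 * s * heats m s x = - heat (dtrig (dtrig m)) s x.
  by rewrite -mulrA heats_eq.
split=> //.
- have cgA : continuous (gA s).
    apply: contM; first by apply: contZ; exact: cE.
    by apply: contM; [exact: heats_cont|exact: (cV 1%N)].
  rewrite mulrA -cintZ; last exact: cont_intg.
  have -> : (fun x => (2 * pi) ^+ 2 * s * gA s x) = (fun x => - (2 * p) *
      (E s x * heat (dtrig (dtrig l)) s x / heat l s x)).
    apply/funext => x; rewrite -[heat (dtrig (dtrig l)) s x]opprK -P /gA; ring.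
  rewrite cintZ; last first.
    apply: cont_intg; apply: contM; last exact: (cV 1%N).
    by apply: contM; [exact: cE|exact: heat_cont].
  have := entropy_dissipation p (heat_derx l s) (heat_derx (dtrig l) s)
    (heat_derx (dtrig (dtrig l)) s) (heat_periodic l s) rs0.
  by rewrite /E => ->; rewrite /K /fisher; ring.
- have p1 : p < 1 by move: p0 p2; lra.
  have := fisher_dissipation (heat_derx l s) (heat_derx (dtrig l) s)
    (heat_derx (dtrig (dtrig l)) s) (@heat_cont _ _ s) (heat_periodic l s) rs0 p0 p1.
  move=> H; apply: le_trans H _.
  rewrite -[J (fun _ => _ `^ _)]/(A s) ler_pM2r//.
  have cgK : continuous (gK s).
    apply: contD; apply: contZ; (apply: contM; first exact: cE).
    + apply: contM; first by apply: contX; exact: heat_cont.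
      apply: contM; first exact: heats_cont.
      by under eq_fun do rewrite exprVn; exact: cV.
    + apply: contM; first exact: heat_cont.
      apply: contM; first exact: heats_cont.
      by under eq_fun do rewrite exprVn; exact: cV.
  rewrite -[leLHS]mulN1r -[leLHS]cintZ; last first.
    apply: cont_intg; apply: contD; apply: contM; try exact: cV.
    + apply: contM; last exact: heat_cont.
      apply: contM; last by apply: contX; exact: heat_cont.
      by apply: contZ; exact: cE.
    + apply: contM; last exact: heat_cont.
      apply: contM; last exact: heat_cont.
      by apply: contZ; exact: cE.
  rewrite [leRHS]mulrA -cintZ; last exact: cont_intg.
  rewrite le_eqVlt; apply/orP; left; apply/eqP; apply: eq_cint => x _.
  have rx : heat l s x != 0 by rewrite gt_eqF.
  rewrite /gK -[heat (dtrig (dtrig l)) s x]opprK -P.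
  rewrite -[heat (dtrig (dtrig (dtrig l))) s x]opprK -P -/(E s x).
  by field.
Qed.

(** With M the 2p-th power of the integral of r, the inequality
    S (M - A) <= p^2 K with its quadratic improvement. *)
Lemma improved_inequality_trig :
  let S := (2 * pi) ^+ 2 * p / (1 - 2 * p) in
  let c := (1 - p) * S / (6 * (1 - 2 * p)) in
  let M := J (trig l) `^ (2 * p) in
  let A1 := mass p (trig l) in
  let K1 := fisher p (trig l) (trig (dtrig l)) in
  A1 <= M /\ S * (M - A1) * M + c * (M - A1) ^+ 2 <= p ^+ 2 * K1 * M.
Proof.
have [h h0 H] := heat_flow_derivatives.
have P0 : 0 < (2 * pi) ^+ 2 :> R by rewrite exprn_gt0// mulr_gt0// pi_gt0.
have A0E : A 0 = J (trig l) `^ (2 * p).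
  rewrite cint_trig -[RHS]cint_cst; apply: eq_cint => x _.
  by rewrite heat_at0.
have K0E : K 0 = 0.
  rewrite -[RHS]cint_cst; apply: eq_cint => x _.
  have -> : heat (dtrig l) 0 x = 0.
    have e : heat l 0 = fun=> heat l 0 0 by apply/funext => y; exact: heat_at0.
    rewrite -(der_derive1 (heat_derx l 0 x)) e.
    exact: der_derive1 (der_cst (heat l 0 0) x).
  by rewrite expr0n/= mulr0 mul0r.
have K0 s : 0 <= K s.
  apply: cint_ge0 => x _; apply: divr_ge0; last exact: sqr_ge0.
  by apply: mulr_ge0; [exact: powR_ge0|exact: sqr_ge0].
have h1E m : heat m 1 = trig m by apply/funext => x; exact: heat_at1.
have := flow_comparison p0 p2 P0 h0 erefl erefl K0 A0E K0E H.
by rewrite /A /K !h1E.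
Qed.

End improved_inequality.

(** * Averaging against a trigonometric kernel *)

Section convolution.
Context {R : realType}.
Local Notation mu := (@lebesgue_measure R).
Local Notation J := (@circle_int R).
Local Notation term := (R * R * int)%type.
Local Notation I01 := (`[0%R, 1%R]%classic : set R).
Local Notation intg f := (mu.-integrable I01 (EFin \o f)).
Implicit Types (l : seq term) (f g h : R -> R) (x t y : R).

Lemma intgM_bounded g h (C : R) : intg g -> measurable_fun I01 h ->
  (forall x, 0 <= x <= 1 -> `|h x| <= C) -> intg (fun x => g x * h x).
Proof.
move=> gi mh hC.
have mg : measurable_fun I01 g by case/integrableP : gi => /measurable_EFinP.
have gi' : intg (fun x => C * `|g x|) by apply: intgZ; exact: integrable_norm.
apply: (le_integrable measurable_I01 _ _ gi') => [|x].
  by apply/measurable_EFinP; exact: measurable_funM.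
rewrite /= in_itv/= => x01.
have C0 : 0 <= C by apply: le_trans (hC x x01).
rewrite !lee_fin normrM [leRHS]ger0_norm ?mulr_ge0//.
by rewrite mulrC ler_wpM2r// hC.
Qed.

Lemma intgM_cont g h : intg g -> continuous h -> intg (fun x => g x * h x).
Proof.
move=> gi ch.
have mh : measurable_fun I01 h by apply: measurable_funTS; exact: continuous_measurable_fun.
have [C hC] : exists C, forall x, 0 <= x <= 1 -> `|h x| <= C.
  have /compact_bounded[M [_ hM]] : compact (h @` I01).
    apply: continuous_compact; last exact: segment_compact.
    exact: continuous_subspaceT.
  exists (M + 1) => x x01; apply: hM; first by rewrite ltrDl.
  by exists x => //; rewrite /= in_itv.
exact: intgM_bounded mh hC.
Qed.

Lemma trig_cat l1 l2 x : trig (l1 ++ l2) x = trig l1 x + trig l2 x.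
Proof. by rewrite /trig big_cat. Qed.

(** The trigonometric kernel cos (pi y) ^ (2 n), not normalised. *)
Definition kern (n : nat) y : R := ((1 + cos (2 * pi * y)) / 2) ^+ n.

Lemma kern_ge0 n y : 0 <= kern n y.
Proof. by rewrite exprn_ge0// divr_ge0//; have := cos_geN1 (2 * pi * y); lra. Qed.

(** The product of [trig l] with (1 + cos (2 pi y)) / 2. *)
Let ctrig l : seq term :=
  [seq (i.1.1 / 2, i.1.2, i.2) | i <- l] ++
  ([seq (i.1.1 / 4, i.1.2, i.2 + 1) | i <- l] ++
   [seq (i.1.1 / 4, i.1.2, i.2 - 1) | i <- l]).

Let ctrigE l y : trig (ctrig l) y = trig l y * ((1 + cos (2 * pi * y)) / 2).
Proof.
rewrite /ctrig !trig_cat /trig !big_map mulr_suml -!big_split /=.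
apply: eq_bigr => -[[a th] k] _; rewrite /tval /= !intrD.
have -> : 2 * pi * (k%:~R + 1%:~R) * y + th = (2 * pi * k%:~R * y + th) + 2 * pi * y by ring.
have -> : 2 * pi * (k%:~R + (-1)%:~R) * y + th = (2 * pi * k%:~R * y + th) - 2 * pi * y.
  by rewrite mulrNz; ring.
by move: (_ * y + th) (2 * pi * y) => X Y; rewrite cosD cosB; field.
Qed.

Lemma kern_trig n : exists l, forall y, kern n y = trig l y.
Proof.
elim: n => [|n [l IH]].
  exists [:: (1, 0, 0)] => y; rewrite /trig big_seq1 /tval/=.
  by rewrite mulr0 mul0r addr0 cos0 mulr1 /kern expr0.
by exists (ctrig l) => y; rewrite ctrigE -IH /kern exprSr.
Qed.

(** The convolution of g with the trigonometric polynomial [trig l]. *)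
Definition tconv l g x : R := J (fun t => g t * trig l (x - t)).

Lemma cont_subl f x : continuous f -> continuous (fun t => f (x - t)).
Proof.
by move=> cf; apply: cont_comp => //; apply: contB; [exact: cont_cst|move=> t; exact: cvg_id].
Qed.

(** The convolution of g with one term. *)
Let cterm g i : seq term :=
  [:: (i.1.1 * J (fun t => g t * cos (2 * pi * i.2%:~R * t - i.1.2)), 0, i.2);
      (i.1.1 * J (fun t => g t * sin (2 * pi * i.2%:~R * t - i.1.2)), - (pi / 2), i.2)].

Let ccos (w th : R) : continuous (fun t : R => cos (w * t - th)).
Proof.
apply: cont_comp; first exact: continuous_cos.
by apply: contB; [apply: contZ => t; exact: cvg_id|exact: cont_cst].
Qed.

Let csin (w th : R) : continuous (fun t : R => sin (w * t - th)).
Proof.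
apply: cont_comp; first exact: continuous_sin.
by apply: contB; [apply: contZ => t; exact: cvg_id|exact: cont_cst].
Qed.

Let tval_cont (i : term) : continuous (tval i).
Proof. exact: der_continuous (tval_der i). Qed.

Let ctermE g i x : intg g -> J (fun t => g t * tval i (x - t)) = trig (cterm g i) x.
Proof.
move=> gi; case: i => -[a th] k.
rewrite /trig big_cons big_seq1 /tval /= addr0.
set w := 2 * pi * k%:~R.
have -> : cos (w * x - pi / 2) = sin (w * x) by rewrite cosBpihalf.
have i1 := intgM_cont gi (@ccos w th).
have i2 := intgM_cont gi (@csin w th).
have -> : (fun t => g t * (a * cos (w * (x - t) + th))) =
   (fun t => (a * cos (w * x)) * (g t * cos (w * t - th)) +
             (a * sin (w * x)) * (g t * sin (w * t - th))).
  apply/funext => t.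
  have -> : w * (x - t) + th = w * x - (w * t - th) by ring.
  by rewrite cosB; ring.
rewrite (cintD (intgZ _ i1) (intgZ _ i2)) (cintZ _ i1) (cintZ _ i2).
by ring.
Qed.

Let tconvE l g x : intg g -> tconv l g x = \sum_(i <- l) trig (cterm g i) x.
Proof.
move=> gi; rewrite /tconv.
have -> : (fun t => g t * trig l (x - t)) = (fun t => \sum_(i <- l) g t * tval i (x - t)).
  by apply/funext => t; rewrite /trig mulr_sumr.
rewrite cint_sum.
  by apply: eq_bigr => i _; exact: ctermE.
by move=> i; apply: intgM_cont => //; apply: cont_subl.
Qed.

Lemma tconv_trig l g : intg g -> exists m, forall x, tconv l g x = trig m x.
Proof.
move=> gi; exists (flatten [seq cterm g i | i <- l]) => x.
rewrite (tconvE _ _ gi); elim: l => [|i l IH]; first by rewrite /trig !big_nil.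
have -> : flatten [seq cterm g j | j <- i :: l] =
          cterm g i ++ flatten [seq cterm g j | j <- l] by [].
by rewrite big_cons trig_cat IH.
Qed.

Lemma cint_tconv l g : intg g -> J (tconv l g) = J g * J (trig l).
Proof.
move=> gi; rewrite (_ : tconv l g = (fun x => \sum_(i <- l) trig (cterm g i) x)); last first.
  by apply/funext => x; exact: tconvE.
rewrite cint_sum; last by move=> i; apply: cont_intg; exact: trig_cont.
rewrite cint_trig /heat mulr_sumr; apply: eq_bigr => i _.
rewrite cint_trig /heat big_cons big_seq1 /=.
case: i => -[a th] k; rewrite /freq2 /tval/= !mulr0 !add0r.
have [->|k0] := eqVneq k 0; last first.
  have -> : (`|k| ^ 2 = (`|k| ^ 2).-1.+1)%N by rewrite prednK// expn_gt0 absz_gt0 k0.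
  by rewrite exprS !mul0r mulr0 addr0.
rewrite absz0 exp0n// !expr0 !mul1r cos0 cosN cos_pihalf.
have -> : (fun t => g t * cos (2 * pi * 0%:~R * t - th)) = (fun t => cos th * g t).
  by apply/funext => t; rewrite mulr0 mul0r add0r cosN mulrC.
by rewrite cintZ//; ring.
Qed.

Lemma tconv_der l g x : intg g -> is_derive x 1 (tconv l g) (tconv (dtrig l) g x).
Proof.
move=> gi; rewrite (_ : tconv l g = (fun x => \sum_(i <- l) trig (cterm g i) x)); last first.
  by apply/funext => y; exact: tconvE.
rewrite (tconvE _ _ gi) /dtrig big_map.
apply: (@der_sum _ _ l (fun i => trig (cterm g i)) (fun i => trig (cterm g (dterm i)))) => i.
apply: (der_eq (trig_der (cterm g i) x)).
case: i => -[a th] k; rewrite /dtrig /trig /= !big_cons !big_nil /tval/= !addr0 addNr.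
set w := 2 * pi * k%:~R.
have -> : (fun t => g t * cos (w * t - (th + pi / 2))) = (fun t => g t * sin (w * t - th)).
  by apply/funext => t; rewrite opprD addrA cosBpihalf.
have -> : (fun t => g t * sin (w * t - (th + pi / 2))) =
          (fun t => (-1) * (g t * cos (w * t - th))).
  by apply/funext => t; rewrite opprD addrA sinBpihalf; ring.
rewrite cintZ; last exact: intgM_cont.
by rewrite add0r cosDpihalf cosBpihalf addr0; ring.
Qed.

(** The reflection of [trig l]. *)
Let trefl l : seq term := [seq (i.1.1, - i.1.2, i.2) | i <- l].

Let treflE l y : trig (trefl l) y = trig l (- y).
Proof.
rewrite /trefl /trig big_map; apply: eq_bigr => -[[a th] k] _; rewrite /tval/=.
by rewrite -cosN; congr (_ * cos _); ring.
Qed.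

Let cterm_sym g h i : intg g -> intg h ->
  J (fun x => h x * trig (cterm g i) x) =
  J (fun t => g t * trig (cterm h (i.1.1, - i.1.2, i.2)) t).
Proof.
move=> gi hi; case: i => -[a th] k /=; pose w : R := 2 * pi * k%:~R.
pose C f := J (fun t => f t * cos (w * t - 0)).
pose S f := J (fun t => f t * sin (w * t - 0)).
have ic f : intg f -> intg (fun t => f t * cos (w * t - 0)) by move=> ?; exact: intgM_cont.
have iS f : intg f -> intg (fun t => f t * sin (w * t - 0)) by move=> ?; exact: intgM_cont.
have cE f (ph : R) : intg f ->
    J (fun t => f t * cos (w * t - ph)) = cos ph * C f + sin ph * S f.
  move=> fi; rewrite /C /S -(cintZ _ (ic _ fi)) -(cintZ _ (iS _ fi)).
  rewrite -(cintD (intgZ _ (ic _ fi)) (intgZ _ (iS _ fi))).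
  by congr J; apply/funext => t; rewrite subr0 cosB; ring.
have sE f (ph : R) : intg f ->
    J (fun t => f t * sin (w * t - ph)) = cos ph * S f + (- sin ph) * C f.
  move=> fi; rewrite /C /S -(cintZ _ (ic _ fi)) -(cintZ _ (iS _ fi)).
  rewrite -(cintD (intgZ _ (iS _ fi)) (intgZ _ (ic _ fi))).
  by congr J; apply/funext => t; rewrite subr0 sinB; ring.
have tE f (P Q : R) : intg f ->
    J (fun t => f t * trig [:: (P, 0, k); (Q, - (pi / 2), k)] t) = P * C f + Q * S f.
  move=> fi; rewrite /C /S -(cintZ _ (ic _ fi)) -(cintZ _ (iS _ fi)).
  rewrite -(cintD (intgZ _ (ic _ fi)) (intgZ _ (iS _ fi))).
  congr J; apply/funext => t; rewrite /trig big_cons big_seq1 /tval/= -/w.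
  by rewrite cosBpihalf subr0 addr0; ring.
rewrite /cterm /= -/w (tE _ _ _ gi) (tE _ _ _ hi) !cE// !sE// cosN sinN.
by ring.
Qed.

Let tconv_sym l g h : intg g -> intg h ->
  J (fun x => h x * tconv l g x) = J (fun t => g t * tconv (trefl l) h t).
Proof.
move=> gi hi.
have E l' f f' : intg f -> intg f' -> J (fun x => f' x * tconv l' f x) =
    \sum_(i <- l') J (fun x => f' x * trig (cterm f i) x).
  move=> fi f'i; rewrite -cint_sum.
    by congr J; apply/funext => x; rewrite (tconvE _ _ fi) mulr_sumr.
  by move=> i; apply: intgM_cont => //; exact: trig_cont.
rewrite (E _ _ _ gi hi) (E _ _ _ hi gi) /trefl big_map.
by apply: eq_bigr => i _; rewrite (cterm_sym i gi hi).
Qed.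

Lemma kern_cont n : continuous (kern n).
Proof.
have [l hl] := kern_trig n.
by rewrite (_ : kern n = trig l); [exact: trig_cont|exact/funext].
Qed.

Lemma kern_periodic n : periodic (kern n) 1.
Proof. by have [l hl] := kern_trig n; move=> x; rewrite !hl trig_periodic. Qed.

Let mass_kern n := J (kern n).

Let cint_kern n x : J (fun t => kern n (x - t)) = mass_kern n.
Proof. by rewrite cint_shift//; [exact: kern_cont|exact: kern_periodic]. Qed.

Let mass_kern_gt0 n : 0 < mass_kern n.
Proof.
rewrite lt_def; apply/andP; split; last by apply: cint_ge0 => x _; exact: kern_ge0.
apply/negP => /eqP m0.
have := cint_eq0_periodic (@kern_cont n) (@kern_periodic n) (kern_ge0 n).
rewrite -[J _]/(mass_kern n) m0 lexx => /(_ isT 0)/eqP.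
by rewrite /kern mulr0 cos0 divff// expr1n oner_eq0.
Qed.

(** The mean value of g with respect to the kernel centred at x. *)
Definition conv n g x : R := J (fun t => g t * kern n (x - t)) / J (kern n).

Let convi n g x : intg g -> intg (fun t => g t * kern n (x - t)).
Proof. by move=> gi; apply: intgM_cont => //; apply: cont_subl; exact: kern_cont. Qed.

Lemma conv_trig n g : intg g -> exists m, forall x, conv n g x = trig m x.
Proof.
move=> gi; have [l hl] := kern_trig n; have [m hm] := tconv_trig l gi.
exists [seq (i.1.1 / J (kern n), i.1.2, i.2) | i <- m] => x.
rewrite /trig big_map /conv.
have -> : (fun t => g t * kern n (x - t)) = (fun t => g t * trig l (x - t)).
  by apply/funext => t; rewrite hl.
rewrite -/(tconv l g x) hm /trig mulr_suml; apply: eq_bigr => i _.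
by rewrite /tval/=; ring.
Qed.

Lemma cint_conv n g : intg g -> J (conv n g) = J g.
Proof.
move=> gi; have [l hl] := kern_trig n.
have kl : kern n = trig l by exact/funext.
have -> : conv n g = (fun x => (J (kern n))^-1 * tconv l g x).
  by apply/funext => x; rewrite /conv mulrC kl.
have [m hm] := tconv_trig l gi.
rewrite cintZ; last first.
  rewrite (_ : tconv l g = trig m); last exact/funext.
  by apply: cont_intg; exact: trig_cont.
rewrite cint_tconv// -kl mulrCA mulVf ?mulr1// gt_eqF//; exact: mass_kern_gt0.
Qed.

(** The derivative of sin (2 pi y) kern n y, with c and s for the cosine and
    the sine. *)
Let kern_der_id n (c s : R) : c ^+ 2 + s ^+ 2 = 1 ->
  c * (2 * pi) * ((1 + c) / 2) ^+ n +
    s * (n%:R * ((1 + c) / 2) ^+ n.-1 * ((0 + - s * (2 * pi)) / 2 + (1 + c) * 0)) =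
  2 * pi * (((1 + c) / 2) ^+ n - n.+1%:R * (((1 + c) / 2) ^+ n * (1 - c))).
Proof.
move=> cs.
have ss : s * s = (1 - c) * (1 + c) by rewrite -expr2 -[s ^+ 2](addKr (c ^+ 2)) cs; ring.
case: n => [|n]; first by rewrite !expr0; ring.
rewrite [n.+1.-1]/= [((1 + c) / 2) ^+ n.+1]exprS mulr0 addr0 add0r.
rewrite -[n.+2%:R]natr1; move: (_ ^+ n) n.+1%:R => P N.
have -> : c * (2 * pi) * ((1 + c) / 2 * P) + s * (N * P * (- s * (2 * pi) / 2)) =
  c * (2 * pi) * ((1 + c) / 2 * P) - s * s * (N * P * pi) by field.
by rewrite ss; field.
Qed.

(** The kernel concentrates: the weight 1 - cos (2 pi y) has mean 1 / (n + 1). *)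
Let kern_moment n x : J (fun t => kern n (x - t) * (1 - cos (2 * pi * (x - t)))) =
  mass_kern n / n.+1%:R.
Proof.
have cc : continuous (fun y => cos (2 * pi * y)).
  by have := @ccos (2 * pi) 0; under eq_fun do rewrite subr0.
have cK := @kern_cont n.
have ch : continuous (fun y => kern n y * (1 - cos (2 * pi * y))).
  by apply: contM => //; apply: contB => //; exact: cont_cst.
rewrite (@cint_shift _ (fun y => kern n y * (1 - cos (2 * pi * y))))//; last first.
  move=> y; rewrite kern_periodic; congr (_ * (_ - _)).
  by have := cos_period 1 (2 * pi * y); rewrite mulr1z mulr1 => <-; congr cos; ring.
pose B y := sin (2 * pi * y) * kern n y.
have dB y : is_derive y 1 B
    (2 * pi * (kern n y - n.+1%:R * (kern n y * (1 - cos (2 * pi * y))))).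
  have a := der_affine (2 * pi) 0 y.
  have {}a : is_derive y 1 (fun y => 2 * pi * y) (2 * pi).
    by move: a; under eq_fun do rewrite addr0.
  have ds := @der_comp _ sin (fun y => 2 * pi * y) y _ _ (is_derive_sin _) a.
  have dc := @der_comp _ cos (fun y => 2 * pi * y) y _ _ (is_derive_cos _) a.
  have dk := derX n (derM (derD (der_cst 1 y) dc) (der_cst 2^-1 y)).
  apply: (der_eq (derM ds dk)).
  exact: kern_der_id (cos2Dsin2 _).
have cb : continuous (fun y => 2 * pi * (kern n y - n.+1%:R * (kern n y * (1 - cos (2 * pi * y))))).
  by apply: contZ; apply: contB => //; exact: contZ.
have := cint_FTC dB cb.
rewrite /B mulr1 mulr0 sin0 mul0r subr0 [2 * pi]mulr_natl sin2pi mul0r.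
rewrite -[pi *+ 2]mulr_natl cintZ; last first.
  by apply: cont_intg; apply: contB => //; exact: contZ.
rewrite cintB; [|exact: cont_intg|by apply: intgZ; exact: cont_intg].
rewrite cintZ; last exact: cont_intg.
move=> /eqP; rewrite mulf_eq0 gt_eqF/= ?mulr_gt0 ?pi_gt0// subr_eq0 => /eqP.
by rewrite -/(mass_kern n) => ->; rewrite [RHS]mulrC mulKf// pnatr_eq0.
Qed.

(** Averaging is symmetric, because the kernel is even. *)
Lemma conv_sym n g h : intg g -> intg h ->
  J (fun x => h x * conv n g x) = J (fun t => g t * conv n h t).
Proof.
move=> gi hi; have [l hl] := kern_trig n.
have kl : kern n = trig l by exact/funext.
have krefl : kern n = trig (trefl l).
  by apply/funext => y; rewrite treflE -hl /kern mulrN cosN.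
have [m1 h1] := tconv_trig l gi; have [m2 h2] := tconv_trig (trefl l) hi.
have i1 : intg (fun x => h x * tconv l g x).
  rewrite (_ : tconv l g = trig m1); last exact/funext.
  by apply: intgM_cont => //; exact: trig_cont.
have i2 : intg (fun x => g x * tconv (trefl l) h x).
  rewrite (_ : tconv _ h = trig m2); last exact/funext.
  by apply: intgM_cont => //; exact: trig_cont.
have -> : (fun x => h x * conv n g x) = (fun x => (J (kern n))^-1 * (h x * tconv l g x)).
  by apply/funext => x; rewrite /conv kl -/(tconv l g x); ring.
have -> : (fun x => g x * conv n h x) =
          (fun x => (J (kern n))^-1 * (g x * tconv (trefl l) h x)).
  by apply/funext => x; rewrite /conv {1}krefl -/(tconv (trefl l) h x); ring.
by rewrite (cintZ _ i1) (cintZ _ i2) tconv_sym.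
Qed.

Lemma conv_ge n g x d : intg g -> (forall t, 0 <= t <= 1 -> d <= g t) -> d <= conv n g x.
Proof.
move=> gi gd; rewrite /conv ler_pdivlMr; last exact: mass_kern_gt0.
rewrite -[J (kern n)]/(mass_kern n) -(cint_kern n x) -cintZ; last first.
  by apply: cont_intg; apply: cont_subl; exact: kern_cont.
apply: cint_le; [|exact: convi|].
- by apply: intgZ; apply: cont_intg; apply: cont_subl; exact: kern_cont.
- by move=> t t01; rewrite ler_wpM2r ?kern_ge0 ?gd.
Qed.

Lemma convN n g x : intg g -> conv n (fun t => - g t) x = - conv n g x.
Proof.
move=> gi; rewrite /conv -mulNr; congr (_ / _).
rewrite -mulN1r -cintZ; last exact: convi.
by congr J; apply/funext => t; ring.
Qed.

Lemma conv_le n g x d : intg g -> (forall t, 0 <= t <= 1 -> g t <= d) -> conv n g x <= d.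
Proof.
move=> gi gd; rewrite -lerN2 -convN//; apply: conv_ge.
  have := intgZ (-1) gi; congr (integrable _ _ _); apply/funext => t /=.
  by rewrite mulN1r.
by move=> t t01; rewrite lerN2 gd.
Qed.

Lemma conv_bound n g x B : intg g -> (forall t, 0 <= t <= 1 -> `|g t| <= B) ->
  `|conv n g x| <= B.
Proof.
move=> gi gB; rewrite ler_norml; apply/andP; split.
  by apply: conv_ge => // t /gB; rewrite ler_norml => /andP[].
by apply: conv_le => // t /gB; rewrite ler_norml => /andP[].
Qed.

(** Jensen's inequality: averaging does not increase the L2 norm. *)
Lemma conv_sqr n g : intg g -> intg (fun t => g t ^+ 2) ->
  J (fun x => conv n g x ^+ 2) <= J (fun t => g t ^+ 2).
Proof.
move=> gi g2i.
have pw x : conv n g x ^+ 2 <= conv n (fun t => g t ^+ 2) x.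
  set m := conv n g x.
  have ck : continuous (fun t => kern n (x - t)) by apply: cont_subl; exact: kern_cont.
  have k0 := mass_kern_gt0 n.
  have i1 := convi n x g2i; have i2 := intgZ (2 * m) (convi n x gi).
  have i3 := intgZ (m ^+ 2) (cont_intg ck).
  have : 0 <= J (fun t => (g t - m) ^+ 2 * kern n (x - t)).
    by apply: cint_ge0 => t _; rewrite mulr_ge0 ?sqr_ge0 ?kern_ge0.
  have -> : (fun t => (g t - m) ^+ 2 * kern n (x - t)) =
    (fun t => g t ^+ 2 * kern n (x - t) - 2 * m * (g t * kern n (x - t))
              + m ^+ 2 * kern n (x - t)) by apply/funext => t; ring.
  rewrite (cintD (intgB i1 i2) i3) (cintB i1 i2) (cintZ _ (convi n x gi)).
  rewrite (cintZ _ (cont_intg ck)) cint_kern.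
  have -> : J (fun t => g t * kern n (x - t)) = m * mass_kern n.
    by rewrite /m /conv divfK// gt_eqF.
  rewrite /conv ler_pdivlMr// -/(mass_kern n); lra.
have [m1 h1] := conv_trig n gi; have [m2 h2] := conv_trig n g2i.
rewrite -[leRHS](cint_conv n)//; apply: cint_le => //.
- apply: cont_intg; apply: contX; rewrite (_ : conv n g = trig m1); last exact/funext.
  exact: trig_cont.
- apply: cont_intg; rewrite (_ : conv _ _ = trig m2); last exact/funext.
  exact: trig_cont.
Qed.

Let conv_error n g x e C : intg g ->
  (forall t, 0 <= t <= 1 -> `|g t - g x| <= e + C * (1 - cos (2 * pi * (x - t)))) ->
  `|conv n g x - g x| <= e + C / n.+1%:R.
Proof.
move=> gi H; have k0 := mass_kern_gt0 n.
have ck : continuous (fun t => kern n (x - t)) by apply: cont_subl; exact: kern_cont.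
have i2 := intgZ (g x) (cont_intg ck).
have cc : continuous (fun t => kern n (x - t) * (1 - cos (2 * pi * (x - t)))).
  apply: (@cont_subl (fun y => kern n y * (1 - cos (2 * pi * y)))).
  apply: contM; first exact: kern_cont.
  apply: contB; first exact: cont_cst.
  by have := @ccos (2 * pi) 0; under eq_fun do rewrite subr0.
have -> : conv n g x - g x = J (fun t => g t * kern n (x - t) - g x * kern n (x - t)) / mass_kern n.
  rewrite (cintB (convi n x gi) i2) (cintZ _ (cont_intg ck)) cint_kern mulrBl.
  by rewrite mulfK// gt_eqF.
rewrite normrM normfV (ger0_norm (ltW k0)) ler_pdivrMr//.
have ii := intgB (convi n x gi) i2.
apply: le_trans (le_norm_cint ii) _.
have i3 := intgZ e (cont_intg ck); have i4 := intgZ C (cont_intg cc).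
have -> : (e + C / n.+1%:R) * mass_kern n = J (fun t => e * kern n (x - t) +
    C * (kern n (x - t) * (1 - cos (2 * pi * (x - t))))).
  rewrite (cintD i3 i4) (cintZ _ (cont_intg ck)) (cintZ _ (cont_intg cc)).
  by rewrite cint_kern kern_moment; ring.
apply: cint_le; [exact: integrable_norm|exact: intgD|].
move=> t t01; rewrite -mulrBl normrM (ger0_norm (kern_ge0 _ _)).
apply: le_trans (ler_wpM2r (kern_ge0 _ _) (H _ t01)) _.
by rewrite le_eqVlt; apply/orP; left; apply/eqP; ring.
Qed.

Let cos_away x d : 0 < d -> d <= x -> d <= 1 - x -> exists2 c, 0 < c &
  forall t, 0 <= t <= 1 -> d <= `|x - t| -> c <= 1 - cos (2 * pi * (x - t)).
Proof.
move=> d0 dx dx1; have p0 := pi_gt0 R.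
have d1 : d <= 2^-1 by lra.
exists (1 - cos (2 * pi * d)).
  rewrite subr_gt0 -[ltRHS]cos0 ltr_cos ?in_itv/= ?lexx ?pi_ge0//.
    by rewrite !mulr_gt0.
  apply/andP; split; first by rewrite !mulr_ge0// ltW.
  by rewrite -[leRHS]mulr1 -mulrA mulrCA ler_wpM2l ?(ltW p0)//; lra.
move=> t /andP[t0 t1]; set y := `|x - t| => dy.
have y1 : y <= 1 - d.
  by rewrite /y ler_norml; apply/andP; split; lra.
have -> : cos (2 * pi * (x - t)) = cos (2 * pi * y).
  rewrite -cos_norm normrM (ger0_norm (_ : 0 <= 2 * pi))// mulr_ge0// ltW//.
have mono (a b : R) : 0 <= a -> a <= b -> b <= 2^-1 -> cos (2 * pi * b) <= cos (2 * pi * a).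
  move=> a0 ab b2.
  have [->//|ab'] := eqVneq a b.
  have pb : forall z : R, 0 <= z -> z <= 2^-1 -> 0 <= 2 * pi * z <= pi.
    move=> z z0 z2; apply/andP; split; first by rewrite !mulr_ge0// ltW.
    by rewrite -[leRHS]mulr1 -mulrA mulrCA ler_wpM2l ?(ltW p0)//; lra.
  apply: ltW; rewrite ltr_cos ?in_itv/= ?pb//; [|lra..].
  by rewrite ltr_pM2l ?mulr_gt0// lt_neqAle ab'.
rewrite lerB//.
have [y2|y2] := leP y 2^-1; first by apply: mono => //; lra.
have -> : cos (2 * pi * y) = cos (2 * pi * (1 - y)).
  rewrite -cosN -(cos_period 1 (- _)); congr cos.
  by rewrite mulr1z; ring.
by apply: mono; lra.
Qed.

(** Away from x the weight 1 - cos (2 pi (x - t)) is bounded below, so a bounded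
    function is recovered from its averages at its continuity points. *)
Lemma conv_cvg g B x : intg g -> (forall t, 0 <= t <= 1 -> `|g t| <= B) ->
  0 < x < 1 -> {for x, continuous g} -> conv n g x @[n --> \oo] --> g x.
Proof.
move=> gi gB /andP[x0 x1] cg; apply/cvgrPdist_le => e e0.
have [d0 d00 hd] : exists2 d, 0 < d & forall t, `|x - t| < d -> `|g x - g t| <= e / 2.
  have /cvgrPdist_le/(_ (e / 2)) := cg; rewrite divr_gt0// => /(_ isT).
  move=> /nbhs_ballP[d d0 hd]; exists d => // t td; exact: hd.
pose d := Num.min d0 (Num.min x (1 - x)).
have dp : 0 < d by rewrite !lt_min d00 x0 subr_gt0.
have ddx : d <= d0 /\ d <= x /\ d <= 1 - x by rewrite /d !ge_min !lexx !orbT.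
have [c c0 hc] := cos_away dp ddx.2.1 ddx.2.2.
have B0 : 0 <= B by apply: le_trans (gB 0 _); rewrite ?lexx ?ler01.
pose C := 2 * B / c.
have C0 : 0 <= C by rewrite divr_ge0 ?mulr_ge0// ltW.
have key n : `|conv n g x - g x| <= e / 2 + C / n.+1%:R.
  apply: conv_error => // t t01.
  have cp : 0 <= 1 - cos (2 * pi * (x - t)) by rewrite subr_ge0 cos_le1.
  have [dt|td] := leP d `|x - t|.
    have H1 : 2 * B <= C * (1 - cos (2 * pi * (x - t))).
      rewrite /C -mulrA ler_peMr ?mulr_ge0// mulrC ler_pdivlMr// mul1r; exact: hc.
    have := ler_normB (g t) (g x); have := gB _ t01.
    have : `|g x| <= B by apply: gB; rewrite !ltW.
    by move: e0; lra.
  have : `|g t - g x| <= e / 2 by rewrite distrC; apply: hd; apply: lt_le_trans td _; case: ddx.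
  have : 0 <= C * (1 - cos (2 * pi * (x - t))) by rewrite mulr_ge0.
  lra.
near=> n; rewrite distrC; apply: le_trans (key n) _.
have : C / n.+1%:R <= e / 2.
  rewrite ler_pdivrMr// -ler_pdivrMl ?divr_gt0//; apply: ltW.
  near: n; exists (Num.truncn ((e / 2)^-1 * C)) => // n /= Cn.
  apply: lt_le_trans (truncnS_gt _) _.
  by rewrite ler_nat ltnS.
by move=> Hc; rewrite [leRHS](splitr e) lerD2l.
Unshelve. all: by end_near. Qed.

End convolution.

(** * Passage to the limit *)

Section limits.
Context {R : realType}.
Local Notation mu := (@lebesgue_measure R).
Local Notation J := (@circle_int R).
Local Notation I01 := (`[0%R, 1%R]%classic : set R).
Local Notation intg f := (mu.-integrable I01 (EFin \o f)).
Implicit Types (f g h G : R -> R) (x t y : R).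

(** A property may be checked on ]0, 1[ away from one point. *)
Lemma ae_I01 (y : R) (P : R -> Prop) : (forall x, 0 < x < 1 -> x != y -> P x) ->
  {ae mu, forall x, I01 x -> P x}.
Proof.
move=> H; have n1 (z : R) : mu.-negligible [set z].
  by exists [set z]; split => //; rewrite lebesgue_measure_set1.
have := negligibleU (n1 0) (negligibleU (n1 1) (n1 y)).
apply: negligibleS => x /= /not_implyP[]; rewrite /= in_itv/= => /andP[x0 x1] nP.
have [->|a] := eqVneq x 0; first by left.
have [->|b] := eqVneq x 1; first by right; left.
have [->|c] := eqVneq x y; first by right; right.
by exfalso; apply: nP; apply: H => //; rewrite !lt_neqAle x0 x1 b eq_sym a.
Qed.

Lemma cint_dct (F : nat -> R -> R) f G :
  (forall n, measurable_fun I01 (F n)) -> measurable_fun I01 f -> intg G ->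
  (forall n x, 0 <= x <= 1 -> `|F n x| <= G x) ->
  {ae mu, forall x, I01 x -> F n x @[n --> \oo] --> f x} ->
  J (F n) @[n --> \oo] --> J f.
Proof.
move=> mF mf iG FG Ff.
have mEF n : measurable_fun I01 (fun x => (F n x)%:E) by apply/measurable_EFinP; exact: mF.
have mEf : measurable_fun I01 (fun x => (f x)%:E) by apply/measurable_EFinP.
have EFf : {ae mu, forall x, I01 x -> (F n x)%:E @[n --> \oo] --> (f x)%:E}.
  apply: filterS Ff; first exact: (ae_filter_ringOfSetsType mu).
  by move=> x Hx Ix; apply: cvg_EFin; [exact: nearW|exact: Hx].
have EFG : {ae mu, forall x n, I01 x -> (`|(F n x)%:E| <= (G x)%:E)%E}.
  by apply: aeW => x n; rewrite /= in_itv/= => x01; rewrite lee_fin; exact: FG.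
have [intf _ H] := dominated_convergence measurable_I01 mEF mEf EFf iG EFG.
apply: fine_cvg; rewrite fineK; first exact: H.
exact: integrable_fin_num.
Qed.

Lemma cont_meas f : continuous f -> measurable_fun I01 f.
Proof. by move=> cf; apply: measurable_funTS; exact: continuous_measurable_fun. Qed.

(** Dominated convergence for uniformly bounded continuous functions. *)
Lemma cint_bct (F : nat -> R -> R) f (C : R) :
  (forall n, continuous (F n)) -> measurable_fun I01 f ->
  (forall n x, 0 <= x <= 1 -> `|F n x| <= C) ->
  (forall x, 0 < x < 1 -> F n x @[n --> \oo] --> f x) ->
  J (F n) @[n --> \oo] --> J f.
Proof.
move=> cF mf FC Ff; apply: (cint_dct _ mf (intg_cst C) FC).
  by move=> n; exact: cont_meas.
by apply: (@ae_I01 0) => x x01 _; exact: Ff.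
Qed.

Lemma cont_bounded01 f : continuous f -> exists C, forall x, 0 <= x <= 1 -> `|f x| <= C.
Proof.
move=> cf; have /compact_bounded[M [_ hM]] : compact (f @` I01).
  apply: continuous_compact; last exact: segment_compact.
  exact: continuous_subspaceT.
exists (M + 1) => x x01; apply: hM; first by rewrite ltrDl.
by exists x => //; rewrite /= in_itv.
Qed.

Lemma cvg_powR (F : nat -> R) (a c : R) : 0 < a -> F n @[n --> \oo] --> a ->
  F n `^ c @[n --> \oo] --> a `^ c.
Proof.
move=> a0 Fa; apply: (@continuous_cvg _ _ _ _ _ _ (fun y => y `^ c)) => //.
exact: der_cont (is_derive1_powR c a0).
Qed.

(** df is a weak derivative of f on the circle, tested against trigonometric
    polynomials only. *)
Definition weak_pair f df := forall l, J (fun t => f t * trig (dtrig l) t) =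
  - J (fun t => df t * trig l t).

Lemma weak_pair_C1 f df : (forall x, is_derive x 1 f (df x)) -> continuous df ->
  periodic f 1 -> weak_pair f df.
Proof.
move=> dF cdf pf l; have cf := der_continuous dF.
have c1 : continuous (fun t => df t * trig l t) by apply: contM => //; exact: trig_cont.
have c2 : continuous (fun t => f t * trig (dtrig l) t) by apply: contM => //; exact: trig_cont.
have := cint_FTC (fun x => derM (dF x) (trig_der l x)) (contD c1 c2).
rewrite (cintD (cont_intg c1) (cont_intg c2)).
rewrite -[1]add0r pf trig_periodic subrr addrC => /eqP.
by rewrite addr_eq0 => /eqP.
Qed.

(** Convolving a weakly differentiable function commutes with differentiation. *)
Lemma conv_der n f df x : intg f -> weak_pair f df ->
  is_derive x 1 (conv n f) (conv n df x).
Proof.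
move=> fi wf; have [l hl] := @kern_trig R n.
have kl : kern n = trig l by exact/funext.
have d := tconv_der l x fi.
have -> : conv n f = (fun x => (J (kern n))^-1 * tconv l f x).
  by apply/funext => y; rewrite /conv mulrC kl.
apply: (der_eq (derZ _ d)).
rewrite /conv mulrC; congr (_ / _).
pose m : seq (R * R * int) := [seq (i.1.1, - (2 * pi * i.2%:~R * x + i.1.2), i.2) | i <- l].
have mE t : trig m t = trig l (x - t).
  rewrite /trig big_map; apply: eq_bigr => -[[a th] k] _; rewrite /tval/=.
  by rewrite -cosN; congr (_ * cos _); ring.
have dmE t : trig (dtrig m) t = - trig (dtrig l) (x - t).
  have d1 := @der_comp _ (trig l) (fun t => x - t) t _ _ (trig_der l (x - t))
    (derB (der_cst x t) (der_id t)).
  rewrite -(der_derive1 (trig_der m t)).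
  have -> : trig m = (fun t => trig l (x - t)) by exact/funext.
  by rewrite (der_derive1 d1); ring.
rewrite /tconv kl.
have -> : (fun t => df t * trig l (x - t)) = (fun t => df t * trig m t).
  by apply/funext => t; rewrite mE.
have -> : (fun t => f t * trig (dtrig l) (x - t)) = (fun t => (-1) * (f t * trig (dtrig m) t)).
  by apply/funext => t; rewrite dmE; ring.
rewrite cintZ; last by apply: intgM_cont => //; exact: trig_cont.
by rewrite wf mulN1r opprK.
Qed.

(** The constant (2 pi)^2 / (q - 2) and the constant of the quadratic
    improvement, in terms of p = 1 / q. *)
Definition sharp_const (p : R) : R := (2 * pi) ^+ 2 * p / (1 - 2 * p).

Definition improved_const (p : R) : R := (1 - p) * sharp_const p / (6 * (1 - 2 * p)).

Lemma improved_limit (S c : R) (Mn An Kn : nat -> R) (M A K : R) :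
  Mn n @[n --> \oo] --> M -> An n @[n --> \oo] --> A -> Kn n @[n --> \oo] --> K ->
  (forall n, An n <= Mn n /\
     S * (Mn n - An n) * Mn n + c * (Mn n - An n) ^+ 2 <= Kn n * Mn n) ->
  A <= M /\ S * (M - A) * M + c * (M - A) ^+ 2 <= K * M.
Proof.
move=> cM cA cK H; split.
  by apply: (ler_cvg_to cA cM); apply: nearW => n; case: (H n).
have MA : Mn n - An n @[n --> \oo] --> M - A by exact: cvgB.
have rhs : Kn n * Mn n @[n --> \oo] --> K * M by exact: cvgM.
have lhs : S * (Mn n - An n) * Mn n + c * ((Mn n - An n) * (Mn n - An n)) @[n --> \oo]
    --> S * (M - A) * M + c * ((M - A) * (M - A)).
  apply: cvgD.
    by apply: cvgM => //; apply: cvgM => //; exact: cvg_cst.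
  by apply: cvgM; [exact: cvg_cst|exact: cvgM].
rewrite expr2; apply: (ler_cvg_to lhs rhs); apply: nearW => n.
by rewrite -expr2; case: (H n).
Qed.

(** By density of trigonometric polynomials; the averages of a positive C^1
    function converge to it together with their derivatives, within the same
    bounds. *)
Lemma improved_inequality_C1 (p d : R) (r r1 : R -> R) : 0 < p -> 2 * p < 1 -> 0 < d ->
  (forall x, is_derive x 1 r (r1 x)) -> continuous r1 -> periodic r 1 ->
  (forall x, d <= r x) ->
  let M := J r `^ (2 * p) in
  let A1 := mass p r in
  let K1 := fisher p r r1 in
  A1 <= M /\ sharp_const p * (M - A1) * M + improved_const p * (M - A1) ^+ 2 <= p ^+ 2 * K1 * M.
Proof.
move=> p0 p2 d0 dr cr1 pr rd M A1 K1.
have cr := der_continuous dr.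
have ri := cont_intg cr; have r1i := cont_intg cr1.
have wp := weak_pair_C1 dr cr1 pr.
have [B hB] := cont_bounded01 cr; have [B1 hB1] := cont_bounded01 cr1.
pose rn n := conv n r; pose sn n := conv n r1.
have drn n x : is_derive x 1 (rn n) (sn n x) by exact: conv_der.
have crn n : continuous (rn n) by exact: der_continuous (drn n).
have csn n : continuous (sn n).
  have [m hm] := conv_trig n r1i.
  by rewrite /sn (_ : conv n r1 = trig m); [exact: trig_cont|exact/funext].
have rnd n x : d <= rn n x by apply: conv_ge.
have rn0 n x : 0 < rn n x by exact: lt_le_trans (rnd n x).
have rnB n x : `|rn n x| <= B by exact: conv_bound.
have snB n x : `|sn n x| <= B1 by exact: conv_bound.
have r0 x : 0 < r x by exact: lt_le_trans (rd x).
have B0 : 0 <= B by apply: le_trans (rnB 0%N 0).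
have rnc x : 0 < x < 1 -> rn n x @[n --> \oo] --> r x.
  by move=> x01; apply: (conv_cvg ri hB x01); exact: cr.
have snc x : 0 < x < 1 -> sn n x @[n --> \oo] --> r1 x.
  by move=> x01; apply: (conv_cvg r1i hB1 x01); exact: cr1.
have powB n x : rn n x `^ (2 * p) <= B `^ (2 * p).
  apply: ge0_ler_powR.
  - by rewrite mulr_ge0// ltW.
  - by rewrite nnegrE ltW.
  - by rewrite nnegrE.
  - by apply: le_trans (rnB n x); exact: ler_norm.
have Mn : J (rn n) `^ (2 * p) @[n --> \oo] --> M.
  apply: cvg_powR.
    apply: lt_le_trans d0 _; rewrite -[leLHS]cint_cst; apply: cint_le => //.
    exact: intg_cst.
  by apply: (@cint_bct _ _ B) => //; exact: cont_meas.
have An : mass p (rn n) @[n --> \oo] --> A1.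
  apply: (@cint_bct (fun n x => rn n x `^ (2 * p)) _ (B `^ (2 * p))).
  - by move=> n; exact: cont_powR.
  - by apply: cont_meas; exact: cont_powR.
  - by move=> n x _; rewrite ger0_norm ?powR_ge0.
  - by move=> x x01; apply: cvg_powR => //; exact: rnc.
have Kn : fisher p (rn n) (sn n) @[n --> \oo] --> K1.
  apply: (@cint_bct (fun n x => rn n x `^ (2 * p) * sn n x ^+ 2 / rn n x ^+ 2) _
    (B `^ (2 * p) * B1 ^+ 2 / d ^+ 2)).
  - move=> n; apply: contM; first by apply: contM; [exact: cont_powR|exact: contX].
    by apply: contV; [exact: contX|move=> x; rewrite expf_neq0// gt_eqF].
  - apply: cont_meas; apply: contM; first by apply: contM; [exact: cont_powR|exact: contX].
    by apply: contV; [exact: contX|move=> x; rewrite expf_neq0// gt_eqF].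
  - move=> n x _; have Es0 : 0 <= rn n x `^ (2 * p) * sn n x ^+ 2.
      by apply: mulr_ge0; [exact: powR_ge0|exact: sqr_ge0].
    rewrite ger0_norm; last by apply: divr_ge0 => //; exact: sqr_ge0.
    apply: ler_pM => //.
    + by rewrite invr_ge0 sqr_ge0.
    + apply: ler_pM; [exact: powR_ge0|exact: sqr_ge0|exact: powB|].
      rewrite -(real_normK (num_real (sn n x))).
      by rewrite lerXn2r ?nnegrE// (le_trans _ (snB n x)).
    + rewrite lef_pV2 ?posrE ?exprn_gt0//.
      by rewrite lerXn2r ?nnegrE ?(ltW d0) ?(ltW (rn0 n x)).
  - move=> x x01; apply: cvgM; first apply: cvgM.
    + by apply: cvg_powR => //; exact: rnc.
    + by apply: (@cvg_comp _ _ _ (sn ^~ x) (fun y => y ^+ 2) _ _ _ (snc x x01)); exact: exprn_continuous.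
    + apply: cvgV; first by rewrite expf_neq0// gt_eqF.
      by apply: (@cvg_comp _ _ _ (rn ^~ x) (fun y => y ^+ 2) _ _ _ (rnc x x01)); exact: exprn_continuous.
have ineq n : mass p (rn n) <= J (rn n) `^ (2 * p) /\
    sharp_const p * (J (rn n) `^ (2 * p) - mass p (rn n)) * J (rn n) `^ (2 * p) +
    improved_const p * (J (rn n) `^ (2 * p) - mass p (rn n)) ^+ 2 <=
    p ^+ 2 * fisher p (rn n) (sn n) * J (rn n) `^ (2 * p).
  have [m hm] := conv_trig n ri.
  have rm : rn n = trig m by exact/funext.
  have sm : sn n = trig (dtrig m).
    apply/funext => x; rewrite -(der_derive1 (drn n x)) rm.
    exact: der_derive1 (trig_der m x).
  have md x : d <= trig m x by rewrite -rm.
  by have := improved_inequality_trig p0 p2 d0 md; rewrite -rm -sm.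
have pKn : p ^+ 2 * fisher p (rn n) (sn n) @[n --> \oo] --> p ^+ 2 * K1.
  by apply: cvgM => //; exact: cvg_cst.
exact: improved_limit Mn An pKn ineq.
Qed.

(** The regularisation (v ^ 2 + e ^ 2) ^ (1 / 2) of |v| is positive, as smooth
    as v, and its derivative is at most that of v in absolute value. *)
Lemma improved_inequality_regularized (q e : R) (v v1 : R -> R) : 2 < q -> 0 < e ->
  (forall x, is_derive x 1 v (v1 x)) -> continuous v1 -> periodic v 1 ->
  let M := J (fun x => (v x ^+ 2 + e ^+ 2) `^ (q / 2)) `^ (2 / q) in
  let A1 := J (fun x => v x ^+ 2 + e ^+ 2) in
  A1 <= M /\ sharp_const q^-1 * (M - A1) * M + improved_const q^-1 * (M - A1) ^+ 2 <=
             J (fun x => v1 x ^+ 2) * M.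
Proof.
move=> q2 e0 dv cv1 pv M A1.
have cv := der_continuous dv.
have q0 : 0 < q by apply: lt_trans q2.
have e2 : 0 < e ^+ 2 by rewrite exprn_gt0.
pose w x := v x ^+ 2 + e ^+ 2.
have w0 x : 0 < w x by rewrite ltr_wpDl ?sqr_ge0.
have dw x : is_derive x 1 w (2 * v x * v1 x).
  by apply: (der_eq (derD (derX 2 (dv x)) (der_cst (e ^+ 2) x))); rewrite addr0 expr1.
have cw := der_continuous dw.
pose r x := w x `^ (q / 2).
pose r1 x := q / 2 * w x `^ (q / 2) * (2 * v x * v1 x / w x).
have dr x : is_derive x 1 r (r1 x) by exact: der_powR.
have cdw : continuous (fun x => 2 * v x * v1 x) by apply: contM => //; exact: contZ.
have cr1 : continuous r1.
  apply: contM; first by apply: contZ; exact: cont_powR.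
  by apply: contM => //; apply: contV => // x; rewrite gt_eqF.
have pr : periodic r 1 by move=> x; rewrite /r /w pv.
pose d := (e ^+ 2) `^ (q / 2).
have d0 : 0 < d by rewrite powR_gt0.
have rd x : d <= r x.
  apply: ge0_ler_powR.
  - by rewrite divr_ge0// ltW.
  - by rewrite nnegrE ltW.
  - by rewrite nnegrE ltW.
  - by rewrite /w lerDr sqr_ge0.
have p0 : 0 < q^-1 by rewrite invr_gt0.
have p2 : 2 * q^-1 < 1 by rewrite ltr_pdivrMr// mul1r.
have rpow x : r x `^ (2 * q^-1) = w x.
  by rewrite /r -powRrM (_ : q / 2 * (2 * q^-1) = 1) ?powRr1 ?(ltW (w0 x))//; field; rewrite gt_eqF.
have [H1 H2] := improved_inequality_C1 p0 p2 d0 dr cr1 pr rd.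
have AE : mass q^-1 r = A1 by apply: eq_cint => x _; exact: rpow.
rewrite AE in H1 H2; split=> //.
apply: le_trans H2 _; apply: ler_wpM2r; first exact: powR_ge0.
have cr := der_continuous dr.
have r0 x : 0 < r x by exact: lt_le_trans (rd x).
rewrite -cintZ; last first.
  apply: cont_intg; apply: contM; first by apply: contM; [exact: cont_powR|exact: contX].
  by apply: contV; [exact: contX|move=> x; rewrite expf_neq0// gt_eqF].
apply: cint_le.
- apply: cont_intg; apply: contZ.
  apply: contM; first by apply: contM; [exact: cont_powR|exact: contX].
  by apply: contV; [exact: contX|move=> x; rewrite expf_neq0// gt_eqF].
- by apply: cont_intg; exact: contX.
- move=> x _; rewrite rpow /r1 -/(r x).
  have rx : r x != 0 by rewrite gt_eqF.
  have wx : w x != 0 by rewrite gt_eqF.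
  have -> : q^-1 ^+ 2 * (w x * (q / 2 * r x * (2 * v x * v1 x / w x)) ^+ 2 / r x ^+ 2) =
     (v x ^+ 2 / w x) * v1 x ^+ 2 by field; rewrite wx rx gt_eqF.
  rewrite ler_piMl ?sqr_ge0// ler_pdivrMr// mul1r /w lerDl ltW//.
Qed.

End limits.

(** * Weakly differentiable functions on the circle *)

Section weak_derivatives.
Context {R : realType}.
Local Notation mu := (@lebesgue_measure R).
Local Notation J := (@circle_int R).
Local Notation I01 := (`[0%R, 1%R]%classic : set R).
Local Notation intg f := (mu.-integrable I01 (EFin \o f)).
Implicit Types (f g h u du : R -> R) (x t y : R).

Lemma intg_meas f : intg f -> measurable_fun I01 f.
Proof. by case/integrableP => /measurable_EFinP. Qed.

Lemma cint_ae f g : measurable_fun I01 f -> measurable_fun I01 g ->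
  {ae mu, forall x, I01 x -> f x = g x} -> J f = J g.
Proof.
move=> mf mg fg; congr fine; apply: ae_eq_integral.
- exact: measurable_I01.
- exact/measurable_EFinP.
- exact/measurable_EFinP.
- apply: filterS fg; first exact: (ae_filter_ringOfSetsType mu).
  by move=> x H Ix; rewrite H.
Qed.

Lemma Lfun1_intg f : circle_Lfun 1 f -> intg f.
Proof.
move=> [_ /Lfun1_integrable]; rewrite -restrict_EFin => H.
exact/(integrable_mkcond _ measurable_I01).
Qed.

Lemma Lfun2_intg_sqr f : circle_Lfun 2%:E f -> intg (fun x => f x ^+ 2).
Proof.
move=> [_ /Lfun2_integrable_sqr H].
apply/(integrable_mkcond _ measurable_I01); rewrite restrict_EFin.
rewrite (_ : _ \_ _ = (fun x => (f \_ I01) x ^+ 2))//.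
by apply/funext => x; rewrite !patchE; case: ifP => // _; rewrite expr0n.
Qed.

Lemma circle_test_trig l : circle_test (@trig R l).
Proof.
split; first exact: trig_periodic.
have H n : derive1n n (trig l) = trig (iter n (@dtrig R) l).
  elim: n => [|n IH] //=; rewrite IH; apply/funext => x.
  exact: der_derive1 (trig_der _ x).
by move=> n t; rewrite H; exact: der_derivable (trig_der _ t).
Qed.

Lemma weak_pair_of u du : circle_weak_derivative u du -> weak_pair u du.
Proof.
move=> [_ _ H] l; rewrite -(H _ (circle_test_trig l)).
congr J; apply/funext => t.
by rewrite (der_derive1 (trig_der l t)).
Qed.

(** The indicator function of ]-oo, y]. *)
Let ind y t : R := (t <= y)%R%:R.

Let ind_meas y : measurable_fun I01 (ind y).
Proof.
have -> : ind y = \1_(`]-oo, y]%classic : set R).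
  by apply/funext => t; rewrite indicE mem_setE in_itv.
apply: measurable_funTS; exact: measurable_indic.
Qed.

Let ind_bound y t : `|ind y t| <= 1.
Proof. by rewrite /ind; case: (t <= y); rewrite ?normr1 ?normr0. Qed.

Let ind_cont y x : x != y -> {for x, continuous (ind y)}.
Proof.
rewrite neq_lt => /orP[xy|yx].
  apply: (@near_cst_continuous R R 1 (ind y) x).
  by near=> t; rewrite /ind ltW//; near: t; exact: lt_nbhsl.
apply: (@near_cst_continuous R R 0 (ind y) x).
by near=> t; rewrite /ind leNgt; have -> : y < t by near: t; exact: lt_nbhsr.
Unshelve. all: by end_near. Qed.

Let ind_intg y : intg (ind y).
Proof.
have H := intgM_bounded (intg_cst 1) (ind_meas y) (fun x _ => ind_bound y x).
by apply: eq_integrable H => // x _ /=; rewrite mul1r.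
Qed.

Let indM g y : intg g -> intg (fun t => g t * ind y t).
Proof. by move=> gi; exact: intgM_bounded gi (ind_meas y) (fun x _ => ind_bound y x). Qed.

Let cint_ind g y : 0 <= y -> y <= 1 ->
  J (fun t => g t * ind y t) = \int[mu]_(t in `[0, y]) g t.
Proof.
move=> y0 y1.
have -> : (`[0, y]%classic : set R) = I01 `&` `]-oo, y]%classic.
  apply/seteqP; split => t /=; rewrite !in_itv/=.
    by move=> /andP[-> ty]; rewrite ty (le_trans ty).
  by move=> [/andP[-> _] ->].
rewrite Rintegral_mkcondr; apply: eq_Rintegral => t _.
rewrite patchE mem_setE in_itv/= /ind; case: (t <= y); first by rewrite mulr1.
by rewrite mulr0.
Qed.

(** The averages of the indicator function are trigonometric polynomials
    converging to it boundedly almost everywhere. *)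
Let conv_ind_cvg g y : intg g ->
  J (fun t => g t * conv n (ind y) t) @[n --> \oo] --> J (fun t => g t * ind y t).
Proof.
move=> gi.
have cc n : continuous (conv n (ind y)).
  have [m hm] := conv_trig n (ind_intg y).
  by rewrite (_ : conv n _ = trig m); [exact: trig_cont|exact/funext].
apply: (@cint_dct _ _ _ (fun x => `|g x|)).
- by move=> n; apply: intg_meas; exact: intgM_cont.
- exact: intg_meas (indM y gi).
- exact: integrable_norm.
- move=> n x _; rewrite normrM ler_piMr//.
  by apply: conv_bound => // t _; exact: ind_bound.
- apply: (@ae_I01 _ y) => x x01 xy; apply: cvgM; first exact: cvg_cst.
  by apply: (@conv_cvg _ _ 1) => //; exact: ind_cont.
Qed.

(** An integrable function orthogonal to all trigonometric polynomials
    vanishes almost everywhere. *)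
Lemma trig_orthogonal_ae0 g : intg g -> (forall l, J (fun t => g t * trig l t) = 0) ->
  {ae mu, forall x, I01 x -> g x = 0}.
Proof.
move=> gi g0.
have gI y : J (fun t => g t * ind y t) = 0.
  have := @conv_ind_cvg g y gi.
  have -> : (fun n => J (fun t => g t * conv n (ind y) t)) = (fun=> 0).
    apply/funext => n; have [m hm] := conv_trig n (ind_intg y).
    by rewrite (_ : conv n _ = trig m)//; exact/funext.
  by move=> /cvg_lim <- //; rewrite lim_cst.
have gi1 : mu.-integrable setT (EFin \o (g \_ I01)).
  by rewrite -restrict_EFin; exact/(integrable_mkcond _ measurable_I01).
have gloc := integrable_locally measurable_I01 gi.
have gi0 y : mu.-integrable [set` Interval (BLeft 0) (BRight y)] (EFin \o (g \_ I01)).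
  exact: integrableS gi1.
have := FTC1 gi0 gloc.
have H0 : {ae mu, forall x, I01 x -> 0 < x < 1} by apply: (@ae_I01 _ 0).
move=> H1; apply: filterS2 H0 H1; first exact: (ae_filter_ringOfSetsType mu).
move=> x H0 H1 Ix; have /andP[x0 x1] := H0 Ix.
have [|_] := H1; first by rewrite (@lte_fin R).
rewrite patchE mem_set// => <-.
set F := (fun y => _).
apply: (@der_derive1 _ F); apply: (near_eq_is_derive _ (der_cst 0 x)).
near=> y.
have y0 : 0 <= y by apply: ltW; near: y; exact: lt_nbhsr.
have y1 : y <= 1 by apply: ltW; near: y; exact: lt_nbhsl.
transitivity (J (fun t => g t * ind y t)); first by rewrite gI.
rewrite cint_ind//; apply: eq_Rintegral => t.
rewrite mem_setE in_itv/= => /andP[t0 ty].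
by rewrite patchE mem_set//= in_itv/= t0 (le_trans ty).
Unshelve. all: by end_near. Qed.

Lemma cvg_powR_ge0 (F : nat -> R) (a c : R) : 0 < c -> (forall n, 0 <= F n) ->
  F n @[n --> \oo] --> a -> F n `^ c @[n --> \oo] --> a `^ c.
Proof.
move=> c0 F0 Fa.
have a0 : 0 <= a.
  by apply: (ler_cvg_to (@cvg_cst _ (0 : R) _ _ _) Fa); exact: nearW.
have [a00|an0] := eqVneq a 0; last by apply: cvg_powR; rewrite // lt_def an0.
rewrite a00 in Fa *; rewrite powR0 ?gt_eqF//; apply/cvgr0Pnorm_le => e e0.
have ec : 0 < e `^ c^-1 by rewrite powR_gt0.
move/cvgr0Pnorm_le : Fa => /(_ _ ec); apply: filterS => n.
rewrite ger0_norm// => Fe; rewrite ger0_norm ?powR_ge0//.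
have -> : e = (e `^ c^-1) `^ c by rewrite -powRrM mulVf ?gt_eqF// powRr1// ltW.
by apply: ge0_ler_powR; rewrite ?nnegrE ?powR_ge0 ?(ltW c0).
Qed.

Section representative.
Variables u du : R -> R.
Hypotheses (ui : intg u) (dui : intg du) (wu : weak_pair u du).

Let v n := conv n u.

Let v_der n x : is_derive x 1 (v n) (conv n du x).
Proof. exact: conv_der. Qed.

Let v_cont n : continuous (v n).
Proof. exact: der_continuous (v_der n). Qed.

Let cdu n : continuous (conv n du).
Proof.
have [m hm] := conv_trig n dui.
by rewrite (_ : conv n _ = trig m); [exact: trig_cont|exact/funext].
Qed.

Let v_per n : periodic (v n) 1.
Proof. by have [m hm] := conv_trig n ui; move=> x; rewrite /v !hm trig_periodic. Qed.

(** The primitive of du. *)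
Let w y := J (fun t => du t * ind y t).

(** By symmetry of the averages, the increments of v n tend to the integral
    of du. *)
Let v_incr n y : 0 <= y <= 1 -> v n y - v n 0 = J (fun t => du t * conv n (ind y) t).
Proof.
move=> /andP[y0 y1]; rewrite -conv_sym//.
have -> : (fun t => ind y t * conv n du t) = (fun t => conv n du t * ind y t).
  by apply/funext => t; rewrite mulrC.
rewrite cint_ind//.
have [->|yn0] := eqVneq y 0.
  by rewrite set_itv1 Rintegral_set1 subrr.
have yp : 0 < y by rewrite lt_def yn0.
rewrite /Rintegral (@continuous_FTC2 R (conv n du) (v n) 0 y)//.
- exact: continuous_subspaceT.
- split.
  + by move=> x _; exact: der_derivable (v_der n x).
  + exact/cvg_at_right_filter/v_cont.
  + exact/cvg_at_left_filter/v_cont.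
- by move=> x _; exact: der_derive1 (v_der n x).
Qed.

Let v_incr_bound n y : 0 <= y <= 1 -> `|v n y - v n 0| <= J (fun t => `|du t|).
Proof.
move=> y01; rewrite v_incr//.
have cc : continuous (conv n (ind y)).
  have [m hm] := conv_trig n (ind_intg y).
  by rewrite (_ : conv n _ = trig m); [exact: trig_cont|exact/funext].
have i1 := intgM_cont dui cc.
apply: le_trans (le_norm_cint i1) _; apply: cint_le.
- exact: integrable_norm.
- exact: integrable_norm.
- move=> t _; rewrite normrM ler_piMr//.
  by apply: conv_bound => // s _; exact: ind_bound.
Qed.

Let v_incr_cvg y : 0 <= y <= 1 -> v n y - v n 0 @[n --> \oo] --> w y.
Proof.
move=> y01; under eq_fun do rewrite v_incr//.
exact: conv_ind_cvg.
Qed.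

Let w_meas : measurable_fun I01 w.
Proof.
apply: (@measurable_fun_cvg _ _ _ _ (fun n y => v n y - v n 0)).
  by move=> n; apply: cont_meas; apply: contB => //; exact: cont_cst.
by move=> y; rewrite /= in_itv/=; exact: v_incr_cvg.
Qed.

Let v0_cvg : v n 0 @[n --> \oo] --> J u - J w.
Proof.
have -> : (fun n => v n 0) = (fun n => J u - J (fun y => v n y - v n 0)).
  apply/funext => n; rewrite cintB ?cint_cst ?cint_conv//.
  - by rewrite subKr.
  - exact: cont_intg.
  - exact: intg_cst.
apply: cvgB; first exact: cvg_cst.
apply: (@cint_bct _ _ _ (J (fun t => `|du t|))).
- by move=> n; apply: contB => //; exact: cont_cst.
- exact: w_meas.
- by move=> n x x01; exact: v_incr_bound.
- by move=> x /andP[x0 x1]; apply: v_incr_cvg; rewrite !ltW.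
Qed.

(** The representative of u, the pointwise limit of its averages. *)
Definition repr_of y : R := (J u - J w) + w y.

Lemma repr_of_cvg y : 0 <= y <= 1 -> conv n u y @[n --> \oo] --> repr_of y.
Proof.
move=> y01.
have -> : (fun n => conv n u y) = (fun n => v n 0 + (v n y - v n 0)).
  by apply/funext => n; rewrite addrC subrK.
by apply: cvgD; [exact: v0_cvg|exact: v_incr_cvg].
Qed.

Lemma repr_of_bounded : exists C, forall n y, 0 <= y <= 1 -> `|conv n u y| <= C.
Proof.
exists (`|J u| + 2 * J (fun t => `|du t|)) => n y y01.
have H1 : `|v n 0 - J u| <= J (fun t => `|du t|).
  rewrite -(cint_conv n ui) -[v n 0]cint_cst.
  have i1 : intg (fun=> v n 0) by exact: intg_cst.
  have i2 : intg (v n) by exact: cont_intg.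
  rewrite -(cintB i1 i2); apply: le_trans (le_norm_cint (intgB i1 i2)) _.
  rewrite -[leRHS]cint_cst; apply: cint_le; [|exact: intg_cst|].
    by apply: integrable_norm; exact: intgB.
  by move=> x x01; rewrite distrC; exact: v_incr_bound.
have H2 := v_incr_bound n y01.
have -> : conv n u y = J u + ((v n 0 - J u) + (v n y - v n 0)) by rewrite /v; ring.
apply: le_trans (ler_normD _ _) _; rewrite lerD2l.
by apply: le_trans (ler_normD _ _) _; rewrite mulr_natl mulr2n lerD.
Qed.

Lemma repr_of_meas : measurable_fun I01 repr_of.
Proof. by apply: measurable_funD => //; exact: measurable_cst. Qed.

Lemma repr_of_bound C : (forall n y, 0 <= y <= 1 -> `|conv n u y| <= C) ->
  forall y, 0 <= y <= 1 -> `|repr_of y| <= C.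
Proof.
move=> hC y y01; have cC : (fun=> C) n @[n --> \oo] --> C by exact: cvg_cst.
have cn : `|conv n u y| @[n --> \oo] --> `|repr_of y|.
  by apply: cvg_norm; exact: repr_of_cvg.
apply: (ler_cvg_to cn cC).
by apply: nearW => n; exact: hC.
Qed.

Lemma repr_of_ae : {ae mu, forall x, I01 x -> u x = repr_of x}.
Proof.
have [C hC] := repr_of_bounded.
have ri : intg repr_of.
  have H := intgM_bounded (intg_cst 1) repr_of_meas (repr_of_bound hC).
  by apply: eq_integrable H => // x _ /=; rewrite mul1r.
have := @trig_orthogonal_ae0 (fun x => u x - repr_of x) (intgB ui ri).
have orth l : J (fun t => (u t - repr_of t) * trig l t) = 0.
  have ct := @trig_cont R l.
  have i1 := intgM_cont ui ct; have i2 := intgM_cont ri ct.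
  have -> : (fun t => (u t - repr_of t) * trig l t) =
            (fun t => u t * trig l t - repr_of t * trig l t).
    by apply/funext => t; rewrite mulrBl.
  rewrite (cintB i1 i2); apply/eqP; rewrite subr_eq0; apply/eqP.
  have [B hB] := cont_bounded01 ct.
  have B0 : 0 <= B by apply: le_trans (hB 0 _); rewrite ?lexx ?ler01.
  have L1 : J (fun t => u t * conv n (trig l) t) @[n --> \oo] --> J (fun t => u t * trig l t).
    apply: (@cint_dct _ _ _ (fun t => B * `|u t|)).
    - move=> n; apply: intg_meas; apply: intgM_cont => //.
      have [m hm] := conv_trig n (cont_intg ct).
      by rewrite (_ : conv n _ = trig m); [exact: trig_cont|exact/funext].
    - exact: intg_meas.
    - by apply: intgZ; exact: integrable_norm.
    - move=> n x x01; rewrite normrM mulrC ler_wpM2r//.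
      by apply: conv_bound => //; exact: cont_intg.
    - apply: (@ae_I01 _ 0) => x x01 _; apply: cvgM; first exact: cvg_cst.
      by apply: (@conv_cvg _ _ B) => //; [exact: cont_intg|exact: ct].
  have L2 : J (fun t => v n t * trig l t) @[n --> \oo] --> J (fun t => repr_of t * trig l t).
    apply: (@cint_bct _ _ _ (C * B)).
    - by move=> n; exact: contM.
    - exact: intg_meas.
    - by move=> n x x01; rewrite normrM ler_pM ?hC ?hB.
    - move=> x /andP[x0 x1]; apply: cvgM; last exact: cvg_cst.
      by apply: repr_of_cvg; rewrite !ltW.
  have E : (fun n => J (fun t => u t * conv n (trig l) t)) =
           (fun n => J (fun t => v n t * trig l t)).
    apply/funext => n; rewrite -(conv_sym n ui (cont_intg ct)).
    by congr J; apply/funext => t; rewrite mulrC.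
  rewrite E in L1.
  by have := cvg_unique _ L1 L2; apply.
move=> /(_ orth); apply: filterS; first exact: (ae_filter_ringOfSetsType mu).
by move=> x H Ix; apply/eqP; rewrite -subr_eq0 H.
Qed.

(** The Poincare inequality for the representative. *)
Lemma repr_of_poincare : intg (fun x => du x ^+ 2) ->
  (2 * pi) ^+ 2 * J (fun x => (repr_of x - J u) ^+ 2) <= J (fun x => du x ^+ 2).
Proof.
move=> du2; have [C hC] := repr_of_bounded.
have L : J (fun x => (v n x - J u) ^+ 2) @[n --> \oo] --> J (fun x => (repr_of x - J u) ^+ 2).
  apply: (@cint_bct _ _ _ ((C + `|J u|) ^+ 2)).
  - by move=> n; apply: contX; apply: contB => //; exact: cont_cst.
  - apply: measurable_funX; apply: measurable_funB; last exact: measurable_cst.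
    exact: repr_of_meas.
  - move=> n x x01; rewrite normrX lerXn2r ?nnegrE ?addr_ge0 ?(le_trans _ (hC n x x01))//.
    by apply: le_trans (ler_normB _ _) _; rewrite lerD2r hC.
  - move=> x /andP[x0 x1].
    have c1 : v n x - J u @[n --> \oo] --> repr_of x - J u.
      by apply: cvgB; [apply: repr_of_cvg; rewrite !ltW|exact: cvg_cst].
    by under eq_fun do rewrite expr2; rewrite expr2; exact: cvgM.
have P0 : 0 < (2 * pi) ^+ 2 :> R by rewrite exprn_gt0// mulr_gt0// pi_gt0.
rewrite mulrC -ler_pdivlMr//.
set b := _ / _; have cb : (fun=> b) n @[n --> \oo] --> b by exact: cvg_cst.
apply: (ler_cvg_to L cb); apply: nearW => n; rewrite /b.
rewrite ler_pdivlMr// mulrC.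
apply: le_trans (conv_sqr n dui du2).
apply: (@wirtinger _ (fun x => v n x - J u)).
- by move=> x; rewrite -[conv n du x]subr0; exact: (derB (v_der n x) (der_cst (J u) x)).
- exact: cdu.
- by move=> x; rewrite v_per.
- by rewrite (cintB (cont_intg (@v_cont n)) (intg_cst _)) cint_cst /v (cint_conv n ui) subrr.
Qed.

(** The improved inequality for weakly differentiable functions. *)
Lemma improved_inequality_weak (q : R) : 2 < q -> intg (fun x => du x ^+ 2) ->
  let X := J (fun x => `|repr_of x| `^ q) in
  let M := X `^ (2 / q) in
  let A := J (fun x => repr_of x ^+ 2) in
  A <= M /\ sharp_const q^-1 * (M - A) * M + improved_const q^-1 * (M - A) ^+ 2 <=
             J (fun x => du x ^+ 2) * M.
Proof.
move=> q2 du2 X M A.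
have q0 : 0 < q by apply: lt_trans q2.
have [C hC] := repr_of_bounded.
have C0 : 0 <= C by apply: le_trans (hC 0%N 0 _); rewrite ?lexx ?ler01.
pose e n : R := n.+1%:R^-1.
have e0 n : 0 < e n by rewrite invr_gt0.
have e1 n : e n <= 1 by rewrite invf_le1// ler1n.
have ec : e n @[n --> \oo] --> (0 : R) by exact: cvg_harmonic.
have e2c : e n ^+ 2 @[n --> \oo] --> (0 : R).
  have : e n * e n @[n --> \oo] --> (0 * 0 : R) by exact: cvgM.
  by rewrite mulr0; under eq_fun do rewrite -expr2.
pose wn n x := v n x ^+ 2 + e n ^+ 2.
have wn0 n x : 0 < wn n x by rewrite ltr_wpDl ?sqr_ge0// exprn_gt0.
have cwn n : continuous (wn n).
  by apply: contD; [exact: contX|exact: cont_cst].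
have wnB n x : 0 <= x <= 1 -> wn n x <= C ^+ 2 + 1.
  move=> x01; apply: lerD; last by rewrite expr_le1// ltW.
  rewrite -(real_normK (num_real (v n x))).
  by rewrite lerXn2r ?nnegrE// hC.
have wnc x : 0 < x < 1 -> wn n x @[n --> \oo] --> repr_of x ^+ 2.
  move=> /andP[x0 x1]; rewrite -[repr_of x ^+ 2]addr0; apply: cvgD => //.
  have c1 : v n x @[n --> \oo] --> repr_of x by apply: repr_of_cvg; rewrite !ltW.
  by under eq_fun do rewrite expr2; rewrite expr2; exact: cvgM.
have powE x : `|repr_of x| `^ q = (repr_of x ^+ 2) `^ (q / 2).
  rewrite -(real_normK (num_real (repr_of x))) -powR_mulrn// -powRrM.
  by congr (_ `^ _); field.
have Xn : J (fun x => wn n x `^ (q / 2)) @[n --> \oo] --> X.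
  have -> : X = J (fun x => (repr_of x ^+ 2) `^ (q / 2)).
    by apply: eq_cint => x _; exact: powE.
  apply: (@cint_bct _ _ _ ((C ^+ 2 + 1) `^ (q / 2))).
  - by move=> n; exact: cont_powR.
  - apply: (@measurableT_comp _ _ _ _ _ _ (fun z : R => z `^ (q / 2))) => //.
    by apply: measurable_funX; exact: repr_of_meas.
  - move=> n x x01; rewrite ger0_norm ?powR_ge0//.
    apply: ge0_ler_powR; rewrite ?nnegrE.
    + by rewrite divr_ge0// ltW.
    + exact: ltW.
    + by rewrite addr_ge0// sqr_ge0.
    + exact: wnB.
  - move=> x x01; apply: cvg_powR_ge0; [by rewrite divr_gt0| |exact: wnc].
    by move=> n; exact: ltW.
have Mn : J (fun x => wn n x `^ (q / 2)) `^ (2 / q) @[n --> \oo] --> M.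
  apply: cvg_powR_ge0 => //; first by rewrite divr_gt0.
  by move=> n; apply: cint_ge0 => x _; exact: powR_ge0.
have An : J (wn n) @[n --> \oo] --> A.
  apply: (@cint_bct _ _ _ (C ^+ 2 + 1)) => //.
  - by apply: measurable_funX; exact: repr_of_meas.
  - by move=> n x x01; rewrite ger0_norm ?wnB// ltW.
have Kn : J (fun x => du x ^+ 2) @[n --> \oo] --> J (fun x => du x ^+ 2).
  exact: cvg_cst.
apply: (improved_limit Mn An Kn) => n.
have [H1 H2] := improved_inequality_regularized q2 (e0 n) (v_der n) (@cdu n) (v_per n).
split=> //; apply: le_trans H2 _; apply: ler_wpM2r; first exact: powR_ge0.
exact: conv_sqr.
Qed.

End representative.

End weak_derivatives.

(** * Stability *)

Section stability.
Context {R : realType}.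
Local Notation mu := (@lebesgue_measure R).
Local Notation J := (@circle_int R).
Local Notation I01 := (`[0%R, 1%R]%classic : set R).
Local Notation intg f := (mu.-integrable I01 (EFin \o f)).

(** Here D is the integral of u' ^ 2, A that of u ^ 2, M the square of the L^q
    norm, and d the squared distance to the constants. If S (M - A) is at most
    half of D then the deficit is at least D / 2; otherwise the quadratic
    improvement in M - A is at least of order D ^ 2 / (D + S A). *)
Lemma stability_of_improved (S c k D A M d : R) : 0 < S -> 0 < c -> 0 < k ->
  0 <= D -> 0 <= A -> A <= M -> S * (M - A) * M + c * (M - A) ^+ 2 <= D * M ->
  0 <= d -> d <= k * D ->
  Num.min (1 / 2) (c / (4 * S)) / k ^+ 2 * (d ^+ 2 / (D + S * A)) <= D + S * A - S * M.
Proof.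
move=> S0 c0 k0 D0 A0 AM H d0 dk.
set m := Num.min _ _.
have m1 : m <= 1 / 2 by rewrite ge_min lexx.
have m2 : m <= c / (4 * S) by rewrite ge_min lexx orbT.
have mp : 0 < m by rewrite lt_min !divr_gt0// mulr_gt0.
have M0 : 0 <= M by exact: le_trans AM.
have SA : 0 <= S * A by rewrite mulr_ge0// ltW.
have delta0 : 0 <= D - S * (M - A).
  have [Mz|Mn] := eqVneq M 0.
    have -> : A = 0 by apply/le_anti; rewrite A0 -Mz AM.
    by rewrite Mz subrr mulr0 subr0.
  have Mp : 0 < M by rewrite lt_def Mn.
  rewrite -(pmulr_lge0 _ Mp) mulrBl subr_ge0; apply: le_trans H.
  by rewrite lerDl mulr_ge0 ?sqr_ge0// ltW.
have -> : D + S * A - S * M = D - S * (M - A) by ring.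
have [Z|Dn] := eqVneq (D + S * A) 0; first by rewrite Z invr0 !mulr0.
have Dp : 0 < D + S * A by rewrite lt_def Dn addr_ge0.
have key : m * D ^+ 2 <= (D - S * (M - A)) * (D + S * A).
  have DD : 0 <= D ^+ 2 by exact: sqr_ge0.
  have [small|large] := leP (S * (M - A)) (D / 2).
    apply: (@le_trans _ _ (D / 2 * D)); last by apply: ler_pM => //; [rewrite divr_ge0|lra|lra].
    have -> : D / 2 * D = (1 / 2) * D ^+ 2 by field.
    by rewrite ler_wpM2r.
  have y0 : 0 <= M - A by rewrite subr_ge0.
  apply: (@le_trans _ _ (S * (c * (M - A) ^+ 2))).
    apply: (@le_trans _ _ (c / (4 * S) * D ^+ 2)); first by rewrite ler_wpM2r.
    have -> : S * (c * (M - A) ^+ 2) = c / (4 * S) * (2 * (S * (M - A))) ^+ 2.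
      by field; rewrite gt_eqF.
    rewrite ler_pM2l ?divr_gt0 ?mulr_gt0//.
    rewrite lerXn2r ?nnegrE// ?mulr_ge0// ?(ltW S0)//.
    by move: large; rewrite ltr_pdivrMr// mulrC => /ltW.
  apply: (@le_trans _ _ ((D - S * (M - A)) * (S * M))).
    by rewrite [leRHS]mulrCA ler_pM2l// mulrBl lerBrDl.
  rewrite ler_wpM2l// -subr_ge0.
  have -> : D + S * A - S * M = D - S * (M - A) by ring.
  exact: delta0.
rewrite mulrA ler_pdivrMr//; apply: le_trans key.
have k2 : 0 < k ^+ 2 by rewrite exprn_gt0.
rewrite -mulrA ler_pM2l// mulrC ler_pdivrMr// mulrC -exprMn.
by rewrite lerXn2r// nnegrE// mulr_ge0// ltW.
Qed.

Lemma sharp_constE (q : R) : 2 < q -> sharp_const q^-1 = (2 * pi) ^+ 2 / (q - 2).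
Proof.
move=> q2; have q0 : q != 0 by rewrite gt_eqF// (lt_trans _ q2).
by rewrite /sharp_const; field; rewrite q0 subr_eq0 gt_eqF.
Qed.

Lemma sharp_const_gt0 (q : R) : 2 < q -> 0 < sharp_const q^-1.
Proof.
by move=> q2; rewrite sharp_constE// divr_gt0 ?subr_gt0// exprn_gt0// mulr_gt0// pi_gt0.
Qed.

Lemma improved_const_gt0 (q : R) : 2 < q -> 0 < improved_const q^-1.
Proof.
move=> q2; have q0 : 0 < q by apply: lt_trans q2.
have q1 : q^-1 < 1 by rewrite invf_lt1//; lra.
have q3 : 2 * q^-1 < 1 by rewrite ltr_pdivrMr// mul1r.
rewrite /improved_const; apply: divr_gt0.
  by apply: mulr_gt0; [rewrite subr_gt0|exact: sharp_const_gt0].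
by apply: mulr_gt0; rewrite ?subr_gt0.
Qed.

Lemma weak_pair_unique (u du du' : R -> R) : intg u -> intg du -> intg du' ->
  weak_pair u du -> weak_pair u du' -> {ae mu, forall x, I01 x -> du x = du' x}.
Proof.
move=> ui di di' w w'.
have H := @trig_orthogonal_ae0 _ (fun x => du x - du' x) (intgB di di').
have orth l : J (fun t => (du t - du' t) * trig l t) = 0.
  have i1 := intgM_cont di (@trig_cont R l); have i2 := intgM_cont di' (@trig_cont R l).
  have -> : (fun t => (du t - du' t) * trig l t) =
            (fun t => du t * trig l t - du' t * trig l t).
    by apply/funext => t; rewrite mulrBl.
  rewrite (cintB i1 i2); apply/eqP; rewrite subr_eq0 -eqr_opp.
  by rewrite -w -w'.
apply: filterS (H orth); first exact: (ae_filter_ringOfSetsType mu).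
by move=> x Hx Ix; apply/eqP; rewrite -subr_eq0 Hx.
Qed.

End stability.

Unset Implicit Arguments.
Set Strict Implicit.

Theorem theorem1 (R : realType) (q : R) (hq : 2 < q) :
  let S : R := (2 * pi) ^+ 2 / (q - 2) in
  exists2 c : R, 0 < c &
    forall u du : R -> R,
      circle_H1 u -> circle_weak_derivative u du ->
      ~ {ae lebesgue_measure, forall t : R, u t = 0} ->
      circle_int (fun t => du t ^+ 2 + S * u t ^+ 2)
        - S * (circle_int (fun t => `|u t| `^ q)) `^ (2 / q)
      >= c * ((circle_int (fun t =>
                 du t ^+ 2 + S * (u t - circle_int u) ^+ 2)) ^+ 2
              / circle_int (fun t => du t ^+ 2 + S * u t ^+ 2)).
Proof.
move=> S; have SE : sharp_const q^-1 = S := sharp_constE hq.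
have S0 : 0 < S by rewrite -SE; exact: sharp_const_gt0.
clearbody S.
have c0 := improved_const_gt0 hq.
have P0 : 0 < (2 * pi) ^+ 2 :> R by rewrite exprn_gt0// mulr_gt0// pi_gt0.
(* k bounds the squared distance to the constants by the integral of u' ^ 2,
   through the Poincare inequality. *)
pose k := 1 + S / (2 * pi) ^+ 2.
have k0 : 0 < k by rewrite addr_gt0// divr_gt0.
exists (Num.min (1 / 2) (improved_const q^-1 / (4 * S)) / k ^+ 2).
  apply: divr_gt0; last by rewrite exprn_gt0.
  rewrite lt_min; apply/andP; split; first by rewrite divr_gt0.
  by apply: divr_gt0 => //; rewrite mulr_gt0.
(* du is only known to be integrable; it agrees almost everywhere with a square
   integrable weak derivative du'. *)
move=> u du [_ [du' hdu2 hw']] hw _.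
have [ui' dui' _] := hw'; have [_ dui0 _] := hw.
have ui := Lfun1_intg ui'; have di' := Lfun1_intg dui'; have di := Lfun1_intg dui0.
have w' := weak_pair_of hw'; have w := weak_pair_of hw.
have du2 := Lfun2_intg_sqr hdu2.
have dudu := weak_pair_unique ui di di' w w'.
pose r := repr_of u du'.
have ur : {ae lebesgue_measure, forall x, `[0, 1]%classic x -> u x = r x} := repr_of_ae ui di' w'.
have rm : measurable_fun (`[0, 1]%classic : set R) r := repr_of_meas ui di' w'.
have [C hC] := repr_of_bounded ui di' w'.
have rC := repr_of_bound ui di' w' hC.
have um := intg_meas ui; have dm := intg_meas di; have dm' := intg_meas di'.
have sqm (f : R -> R) : measurable_fun (`[0, 1]%classic : set R) f ->
    measurable_fun (`[0, 1]%classic : set R) (fun x => f x ^+ 2).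
  by move=> mf; exact: measurable_funX.
have Sqm (f : R -> R) : measurable_fun (`[0, 1]%classic : set R) f ->
    measurable_fun (`[0, 1]%classic : set R) (fun x => S * f x ^+ 2).
  by move=> mf; apply: measurable_funM; [exact: measurable_cst|exact: sqm].
have cm (f : R -> R) (a : R) : measurable_fun (`[0, 1]%classic : set R) f ->
    measurable_fun (`[0, 1]%classic : set R) (fun x => f x - a).
  by move=> mf; apply: measurable_funB => //; exact: measurable_cst.
have bint (f : R -> R) (B : R) : measurable_fun (`[0, 1]%classic : set R) f ->
    (forall x, 0 <= x <= 1 -> `|f x| <= B) ->
    lebesgue_measure.-integrable (`[0, 1]%classic : set R) (EFin \o f).
  move=> mf fB; have H := intgM_bounded (intg_cst 1) mf fB.
  by apply: eq_integrable H => // x _ /=; rewrite mul1r.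
have r2i : lebesgue_measure.-integrable (`[0, 1]%classic : set R) (EFin \o (fun x => r x ^+ 2)).
  apply: (bint _ (C ^+ 2)); first exact: sqm.
  move=> x x01; rewrite normrX lerXn2r ?nnegrE ?(le_trans _ (rC x x01))//; exact: rC.
have rci : lebesgue_measure.-integrable (`[0, 1]%classic : set R)
    (EFin \o (fun x => (r x - circle_int u) ^+ 2)).
  apply: (bint _ ((C + `|circle_int u|) ^+ 2)); first by apply: sqm; exact: cm.
  move=> x x01; have H := rC x x01.
  have H1 : `|r x - circle_int u| <= C + `|circle_int u|.
    by apply: le_trans (ler_normB _ _) _; rewrite lerD2r.
  by rewrite normrX lerXn2r ?nnegrE// (le_trans _ H1).
have E1 : circle_int (fun t => du t ^+ 2 + S * u t ^+ 2) =
    circle_int (fun t => du' t ^+ 2) + S * circle_int (fun t => r t ^+ 2).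
  rewrite -(cintZ _ r2i) -(cintD du2 (intgZ _ r2i)); apply: cint_ae.
  - by apply: measurable_funD; [exact: sqm|exact: Sqm].
  - by apply: measurable_funD; [exact: sqm|exact: Sqm].
  - apply: filterS2 dudu ur; first exact: (ae_filter_ringOfSetsType (@lebesgue_measure R)).
    by move=> x h1 h2 Ix; rewrite h1// h2.
have E2 : circle_int (fun t => du t ^+ 2 + S * (u t - circle_int u) ^+ 2) =
    circle_int (fun t => du' t ^+ 2) + S * circle_int (fun t => (r t - circle_int u) ^+ 2).
  rewrite -(cintZ _ rci) -(cintD du2 (intgZ _ rci)); apply: cint_ae.
  - by apply: measurable_funD; [exact: sqm|apply: Sqm; exact: cm].
  - by apply: measurable_funD; [exact: sqm|apply: Sqm; exact: cm].
  - apply: filterS2 dudu ur; first exact: (ae_filter_ringOfSetsType (@lebesgue_measure R)).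
    by move=> x h1 h2 Ix; rewrite h1// h2.
have qm (f : R -> R) : measurable_fun (`[0, 1]%classic : set R) f ->
    measurable_fun (`[0, 1]%classic : set R) (fun x => `|f x| `^ q).
  move=> mf; apply: (@measurableT_comp _ _ _ _ _ _ (fun z : R => z `^ q)) => //.
  exact: measurableT_comp.
have E3 : circle_int (fun t => `|u t| `^ q) = circle_int (fun t => `|r t| `^ q).
  apply: cint_ae; [exact: qm|exact: qm|].
  apply: filterS ur; first exact: (ae_filter_ringOfSetsType (@lebesgue_measure R)).
  by move=> x h Ix; rewrite h.
rewrite E1 E2 E3.
have [AM H] := improved_inequality_weak ui di' w' hq du2.
have poin := repr_of_poincare ui di' w' du2.
rewrite SE in H.
have D0 : 0 <= circle_int (fun t => du' t ^+ 2) by apply: cint_ge0 => x _; exact: sqr_ge0.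
have V0 : 0 <= circle_int (fun t => (r t - circle_int u) ^+ 2).
  by apply: cint_ge0 => x _; exact: sqr_ge0.
have A0 : 0 <= circle_int (fun t => r t ^+ 2) by apply: cint_ge0 => x _; exact: sqr_ge0.
apply: stability_of_improved => //.
- by rewrite addr_ge0// mulr_ge0// ltW.
- rewrite /k mulrDl mul1r lerD2l -mulrA ler_pM2l// mulrC ler_pdivlMr// mulrC.
  exact: poin.
Qed.
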